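(* For every continuous theory $T$ there is a metric theory $U$ (possibly in a different vocabulary) such that $T$ and $U$ are $\trianglelefteq$-equivalent, i.e. $T\trianglelefteq U$ and $U\trianglelefteq T$.
   Context: A vocabulary $V$ is a countable set of constant, function and predicate symbols. A real-valued $V$-structure has a nonempty universe $M$, interpretations of constants in $M$, functions $M^n\to M$, and predicates $M^n\to[0,1]$. Continuous $V$-formulas are built from atomic formulas using continuous functions $[0,1]^n\to[0,1]$ as connectives and $\sup,\inf$ as quantifiers, with value $0$ meaning truth. A metric signature $L$ over $V$ specifies a binary predicate symbol $d\in V$ and a modulus of uniform continuity for each function and predicate symbol; an $L$-metric structure is a $V$-structure where $d$ is interpreted as a complete metric and every symbol respects its modulus; a metric structure is an $L$-metric structure for some $L$. $\mathrm{Th}(\mathcal M)$ is the set of $V$-sentences with value $0$ in $\mathcal M$; a continuous theory is $\mathrm{Th}(\mathcal M)$ for a real-valued structure $\mathcal M$, a metric theory is $\mathrm{Th}(\mathcal M)$ for a metric structure $\mathcal M$; $\mathcal M$ is a model of $T$ if every sentence of $T$ has value $0$ in $\mathcal M$. A structure is $\kappa$-saturated if every set of formulas with parameters from fewer than $\kappa$ elements that is finitely satisfiable (every finite subset has a common solution giving value $0$) is satisfiable. For an ultrafilter $\mathcal D$ over $I$, the ultrapower $\mathcal M_{\mathcal D}$ has universe $M^I$ modulo indistinguishability by atomic formulas, constants/functions coordinatewise and predicates given by $\mathcal D$-limits. $\mathcal D$ over $I$, $|I|=\lambda$ infinite, is regular if there is $\mathcal X\subseteq\mathcal D$ of cardinality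 $\lambda$ with each $t\in I$ in only finitely many members of $\mathcal X$. $\mathcal D$ saturates $\mathcal M$ if $\mathcal M_{\mathcal D}$ is $\lambda^+$-saturated; $\mathrm{Sat}(T)$ is the class of regular ultrafilters saturating every model of $T$. For continuous theories $T,U$ with possibly different vocabularies, $T\trianglelefteq U$ means $\mathrm{Sat}(U)\subseteq\mathrm{Sat}(T)$. *)

(* Defs.v *)
From HB Require Import structures.
From mathcomp Require Import all_boot all_order all_algebra.
From mathcomp Require Import all_classical all_reals all_analysis.

Set Implicit Arguments.
Unset Strict Implicit.
Unset Printing Implicit Defensive.

Import Order.TTheory GRing.Theory Num.Theory.
Import numFieldNormedType.Exports.
Local Open Scope classical_set_scope.
Local Open Scope card_scope.
Local Open Scope quotient_scope.
Local Open Scope ring_scope.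

(* A set of symbols of any cardinality.  A vocabulary is a countable one; the
   expansion of a vocabulary by constants for parameters need not be. *)
Record language := Language {
  csymb : Type;
  fsymb : Type;
  psymb : Type;
  farity : fsymb -> nat;
  parity : psymb -> nat }.

Record vocabulary := Vocabulary {
  vocabulary_language :> language;
  countable_csymb : countable [set: csymb vocabulary_language];
  countable_fsymb : countable [set: fsymb vocabulary_language];
  countable_psymb : countable [set: psymb vocabulary_language] }.

Record structure (R : realType) (L : language) := Structure {
  universe :> Type;
  universe_inhabited : inhabited universe;
  cinterp : csymb L -> universe;
  finterp : forall f : fsymb L, ('I_(farity f) -> universe) -> universe;
  pinterp : forall p : psymb L, ('I_(parity p) -> universe) -> R;
  pinterp_01 : forall p x, 0 <= pinterp (p := p) x <= 1 }.

Definition unit_cube (R : realType) (n : nat) : set 'rV[R]_n :=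
  [set x | forall i, 0 <= x ord0 i <= 1].

(* Continuous functions [0,1]^n -> [0,1], represented by functions on R^n whose
   values outside the cube play no role. *)
Record connective (R : realType) (n : nat) := Connective {
  conn_fun :> 'rV[R]_n -> R;
  conn_continuous : {within @unit_cube R n, continuous conn_fun};
  conn_01 : forall x, @unit_cube R n x -> 0 <= conn_fun x <= 1 }.

Inductive term (L : language) : Type :=
| Var (x : nat)
| Cst (c : csymb L)
| App (f : fsymb L) (t : 'I_(farity f) -> term L).

Arguments Var {L}.
Arguments Cst {L}.
Arguments App {L}.

Inductive formula (R : realType) (L : language) : Type :=
| Atom (p : psymb L) (t : 'I_(parity p) -> term L)
| Conn (n : nat) (c : connective R n) (phi : 'I_n -> formula R L)
| Sup (x : nat) (phi : formula R L)
| Inf (x : nat) (phi : formula R L).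

Arguments Atom {R L}.
Arguments Conn {R L}.
Arguments Sup {R L}.
Arguments Inf {R L}.

Fixpoint occurs (L : language) (x : nat) (t : term L) : Prop :=
  match t with
  | Var y => x = y
  | Cst _ => False
  | App f ts => exists i, occurs x (ts i)
  end.

Fixpoint free (R : realType) (L : language) (x : nat) (phi : formula R L) :
    Prop :=
  match phi with
  | Atom p ts => exists i, occurs x (ts i)
  | Conn n c psi => exists i, free x (psi i)
  | Sup y psi => x <> y /\ free x psi
  | Inf y psi => x <> y /\ free x psi
  end.

Definition sentence (R : realType) (L : language) (phi : formula R L) : Prop :=
  forall x, ~ free x phi.

Definition update (M : Type) (s : nat -> M) (x : nat) (a : M) : nat -> M :=
  fun y => if y == x then a else s y.

Fixpoint teval (R : realType) (L : language) (M : structure R L)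
    (s : nat -> M) (t : term L) : M :=
  match t with
  | Var x => s x
  | Cst c => cinterp M c
  | App f ts => finterp (fun i => teval s (ts i))
  end.

Fixpoint value (R : realType) (L : language) (M : structure R L)
    (s : nat -> M) (phi : formula R L) : R :=
  match phi with
  | Atom p ts => pinterp (fun i => teval s (ts i))
  | Conn n c psi => c (\row_i value s (psi i))
  | Sup x psi => sup [set value (update s x a) psi | a in [set: M]]
  | Inf x psi => inf [set value (update s x a) psi | a in [set: M]]
  end.

Definition theory (R : realType) (L : language) := set (formula R L).

Definition Th (R : realType) (L : language) (M : structure R L) : theory R L :=
  [set phi | sentence phi /\ forall s : nat -> M, value s phi = 0].

Definition model (R : realType) (L : language) (T : theory R L)
    (M : structure R L) : Prop :=
  T `<=` Th M.

Definition continuous_theory (R : realType) (V : vocabulary)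
    (T : theory R V) : Prop :=
  exists M : structure R V, T = Th M.

(* A modulus of uniform continuity is a function (0,1] -> (0,1]; only its
   values on (0,1] are used. *)
Record modulus (R : realType) := Modulus {
  modulus_fun :> R -> R;
  modulus_01 : forall e, 0 < e <= 1 -> 0 < modulus_fun e <= 1 }.

Record metric_signature (R : realType) (V : vocabulary) := MetricSignature {
  dist_symb : psymb V;
  dist_arity : parity dist_symb = 2%N;
  fmodulus : fsymb V -> modulus R;
  pmodulus : psymb V -> modulus R }.

(* The pair (x, y) as a tuple indexed by 'I_n, meant for n = 2. *)
Definition pair_tuple (M : Type) (n : nat) (x y : M) : 'I_n -> M :=
  fun i => if val i == 0%N then x else y.

Definition sdist (R : realType) (V : vocabulary) (L : metric_signature R V)
    (M : structure R V) (x y : M) : R :=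
  pinterp (p := dist_symb L) (pair_tuple x y).

Definition is_metric (R : realType) (M : Type) (d : M -> M -> R) : Prop :=
  [/\ forall x y, d x y = 0 <-> x = y,
      forall x y, d x y = d y x &
      forall x y z, d x z <= d x y + d y z].

Definition cauchy_complete (R : realType) (M : Type) (d : M -> M -> R) : Prop :=
  forall u : nat -> M,
    (forall e, 0 < e -> exists N, forall m n, (N <= m)%N -> (N <= n)%N ->
       d (u m) (u n) < e) ->
    exists l, forall e, 0 < e -> exists N, forall n, (N <= n)%N -> d (u n) l < e.

Definition L_metric_structure (R : realType) (V : vocabulary)
    (L : metric_signature R V) (M : structure R V) : Prop :=
  [/\ is_metric (@sdist R V L M),
      cauchy_complete (@sdist R V L M),
      forall (f : fsymb V) (x y : 'I_(farity f) -> M) e, 0 < e <= 1 ->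
        (forall i, sdist L (x i) (y i) < fmodulus L f e) ->
        sdist L (finterp x) (finterp y) <= e &
      forall (p : psymb V) (x y : 'I_(parity p) -> M) e, 0 < e <= 1 ->
        (forall i, sdist L (x i) (y i) < pmodulus L p e) ->
        `|pinterp x - pinterp y| <= e].

Definition metric_structure (R : realType) (V : vocabulary)
    (M : structure R V) : Prop :=
  exists L : metric_signature R V, L_metric_structure L M.

Definition metric_theory (R : realType) (V : vocabulary) (T : theory R V) :
    Prop :=
  exists M : structure R V, metric_structure M /\ T = Th M.

Definition add_constants (L : language) (C : Type) : language :=
  {| csymb := csymb L + C;
     fsymb := fsymb L;
     psymb := psymb L;
     farity := @farity L;
     parity := @parity L |}.

Definition expand (R : realType) (L : language) (M : structure R L)
    (A : set M) : structure R (add_constants L A) :=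
  @Structure R (add_constants L A) M (universe_inhabited M)
    (fun c => match c with inl c => cinterp M c | inr a => val a end)
    (@finterp R L M) (@pinterp R L M) (@pinterp_01 R L M).

Definition satisfiable (R : realType) (L : language) (M : structure R L)
    (G : set (formula R L)) : Prop :=
  exists s : nat -> M, forall phi, G phi -> value s phi = 0.

Definition finitely_satisfiable (R : realType) (L : language)
    (M : structure R L) (G : set (formula R L)) : Prop :=
  forall F, F `<=` G -> finite_set F -> satisfiable M F.

(* kappa-saturation for kappa the successor of the cardinality of I: having
   fewer than kappa elements is having at most #|I| elements. *)
Definition succ_saturated (I : Type) (R : realType) (L : language)
    (M : structure R L) : Prop :=
  forall A : set M, A #<= [set: I] ->
  forall G : set (formula R (add_constants L A)),
    finitely_satisfiable (expand A) G -> satisfiable (expand A) G.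

Record ultrafilter (I : Type) := Ultrafilter {
  ultrafilter_sets :> set_system I;
  ultrafilterP : UltraFilter ultrafilter_sets }.

#[global] Existing Instance ultrafilterP.

Lemma ultra_lim_01 (R : realType) (I : Type) (D : ultrafilter I) (g : I -> R) :
  (forall t, 0 <= g t <= 1) -> 0 <= lim (g x @[x --> ultrafilter_sets D]) <= 1.
Proof.
move=> g01.
have UD := ultrafilterP D.
have PD : ProperFilter (ultrafilter_sets D) by exact: ultra_proper.
have cg : cvg (g x @[x --> ultrafilter_sets D]).
  have gD : UltraFilter (g x @[x --> ultrafilter_sets D]).
    split; first exact: fmap_proper_filter.
    move=> G PG gG; rewrite eqEsubset; split; last exact: gG.
    move=> B GB; case: (in_ultra_setVsetC (g @^-1` B) UD) => // nB.
    have GC : G (~` B) by exact: gG.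
    have : G set0 by rewrite -(setICr B); exact: filterI.
    by move/filter_not_empty.
  have := @segment_compact R 0 1.
  rewrite compact_ultra => /(_ _ gD)[].
    by apply: (@filterE _ (ultrafilter_sets D)) => t; rewrite /= in_itv /= g01.
  by move=> l [_ gl]; apply/cvg_ex; exists l.
apply/andP; split; [apply: limr_ge|apply: limr_le] => //;
  by apply: filterE => t; case/andP: (g01 t).
Qed.

Definition pre_ultrapower (R : realType) (L : language) (M : structure R L)
    (I : Type) (D : ultrafilter I) : structure R L :=
  @Structure R L (I -> M)
    (let: inhabits a := universe_inhabited M in inhabits (fun=> a))
    (fun c => fun=> cinterp M c)
    (fun f x => fun t => finterp (fun i => x i t))
    (fun p x => lim (pinterp (fun i => x i t) @[t --> ultrafilter_sets D]))
    (fun p x => ultra_lim_01 D (fun t => pinterp_01 _)).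

Definition indistinguishable (R : realType) (L : language) (M : structure R L)
    (a b : M) : Prop :=
  forall (p : psymb L) (t : 'I_(parity p) -> term L) (x : nat) (s : nat -> M),
    value (update s x a) (Atom p t) = value (update s x b) (Atom p t).

Definition indist_rel (R : realType) (L : language) (M : structure R L) :
    rel {classic M} :=
  fun a b => `[< indistinguishable (M := M) a b >].

Lemma indist_refl (R : realType) (L : language) (M : structure R L) :
  reflexive (@indist_rel R L M).
Proof. by move=> a; apply/asboolP. Qed.

Lemma indist_sym (R : realType) (L : language) (M : structure R L) :
  symmetric (@indist_rel R L M).
Proof.
by move=> a b; apply/asboolP/asboolP => ab p t x s; rewrite (ab p t x s).
Qed.

Lemma indist_trans (R : realType) (L : language) (M : structure R L) :
  transitive (@indist_rel R L M).
Proof.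
move=> b a c /asboolP ab /asboolP bc; apply/asboolP => p t x s.
by rewrite (ab p t x s) (bc p t x s).
Qed.

Definition indist (R : realType) (L : language) (M : structure R L) :
    equiv_rel {classic M} :=
  EquivRel (@indist_rel R L M) (@indist_refl R L M) (@indist_sym R L M)
    (@indist_trans R L M).

(* The quotient of M by indistinguishability.  Symbols are interpreted through
   representatives; their choice does not matter, since indistinguishability is
   a congruence for all symbols. *)
Definition reduction (R : realType) (L : language) (M : structure R L) :
    structure R L :=
  @Structure R L {eq_quot indist M}
    (let: inhabits a := universe_inhabited M in
     inhabits (\pi_{eq_quot indist M} (a : {classic M})))
    (fun c => \pi_{eq_quot indist M} (cinterp M c : {classic M}))
    (fun f x => \pi_{eq_quot indist M}
       (finterp (fun i => repr (x i) : M) : {classic M}))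
    (fun p x => pinterp (fun i => repr (x i) : M))
    (fun p x => pinterp_01 _).

Definition ultrapower (R : realType) (L : language) (M : structure R L)
    (I : Type) (D : ultrafilter I) : structure R L :=
  reduction (pre_ultrapower M D).

Definition regular (I : Type) (D : ultrafilter I) : Prop :=
  infinite_set [set: I] /\
  exists X : set (set I),
    [/\ X `<=` D, X #= [set: I] & forall t, finite_set (X `&` [set Y | Y t])].

Definition saturates (R : realType) (L : language) (I : Type)
    (D : ultrafilter I) (M : structure R L) : Prop :=
  succ_saturated I (ultrapower M D).

Definition Sat (R : realType) (L : language) (T : theory R L) (I : Type)
    (D : ultrafilter I) : Prop :=
  regular D /\ forall M : structure R L, model T M -> saturates D M.

Definition keisler_le (R : realType) (L L' : language) (T : theory R L)
    (U : theory R L') : Prop :=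
  forall (I : Type) (D : ultrafilter I), Sat U D -> Sat T D.

(* Main.v *)
(** Enumerate the pairs (atomic formula, variable) of V, and let rho_k (a, b) be
    the supremum, over the values of the other variables, of the change of the
    k-th atomic formula when its distinguished variable moves from a to b.  Then
    d = sup_k 2^-k rho_k is a pseudometric for which all symbols are uniformly
    continuous and whose kernel is indistinguishability.  It is a uniform limit
    of formulas of V, so sentences can say that a new symbol d is this
    pseudometric, and in every structure satisfying them each formula with d is
    a uniform limit of formulas of V.  Hence adding or forgetting d turns models
    of T and of U := Th (M, d) into each other, commutes with ultrapowers, and
    changes neither which sets of conditions are finitely satisfiable nor which
    are satisfiable.  U is a metric theory because an ultrapower of (M, d) over
    a nonprincipal ultrafilter on nat is elementarily equivalent to (M, d) and
    its metric is complete. *)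

Require Import Defs.
From mathcomp Require Import all_boot all_order all_algebra.
From mathcomp Require Import all_classical all_reals all_analysis.
From mathcomp Require Import lra.

Set Implicit Arguments.
Unset Strict Implicit.
Unset Printing Implicit Defensive.

Import Order.TTheory GRing.Theory Num.Theory.
Import numFieldNormedType.Exports.
Local Open Scope classical_set_scope.
Local Open Scope card_scope.
Local Open Scope quotient_scope.
Local Open Scope ring_scope.

(** * Suprema, connectives and ultralimits in the unit interval *)

(** The distance has to be controlled by formulas of V. The discrete metric would also make every
    symbol uniformly continuous, but in general it is no uniform limit of formulas of V, so
    saturation of V-structures would say nothing about conditions that mention it.

    Atomic formulas are enumerated, rather than predicate symbols, because of the function symbols:
    substituting a value of f into an atomic formula gives another atomic formula of the list, so
    continuity of f reduces to continuity of atomic formulas. The supremum over the other variables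
    makes the control uniform in them.

    A condition with d has in general no exact equivalent without d. It is traded for infinitely
    many approximate conditions, which is harmless because saturation concerns infinite sets of
    conditions anyway.

    Separation and completeness are not asked of the models of U. They are arranged only in the one
    structure that shows U to be a metric theory: the quotient by indistinguishability gives
    separation, and a diagonal argument in the ultrapower gives completeness. *)

Section UnitSup.
Variables (R : realType) (T : Type) (g : T -> R).
Hypothesis g01 : forall a, 0 <= g a <= 1.

Lemma sup_image_ub a : g a <= sup [set g a | a in [set: T]].
Proof.
apply: ub_le_sup; last by exists a.
by exists 1 => _ [b _ <-]; case/andP: (g01 b).
Qed.

Lemma inf_image_lb a : inf [set g a | a in [set: T]] <= g a.
Proof.
apply: ge_inf; last by exists a.
by exists 0 => _ [b _ <-]; case/andP: (g01 b).
Qed.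

Hypothesis T0 : inhabited T.

Lemma sup_image_le c : (forall a, g a <= c) -> sup [set g a | a in [set: T]] <= c.
Proof.
move=> gc; apply: ge_sup => [|_ [b _ <-]//].
by case: T0 => a; exists (g a), a.
Qed.

Lemma inf_image_ge c : (forall a, c <= g a) -> c <= inf [set g a | a in [set: T]].
Proof.
move=> gc; apply: lb_le_inf => [|_ [b _ <-]//].
by case: T0 => a; exists (g a), a.
Qed.

Lemma sup_image_01 : 0 <= sup [set g a | a in [set: T]] <= 1.
Proof.
apply/andP; split; last by apply: sup_image_le => a; case/andP: (g01 a).
by case: T0 => a; apply: le_trans (sup_image_ub a); case/andP: (g01 a).
Qed.

Lemma inf_image_01 : 0 <= inf [set g a | a in [set: T]] <= 1.
Proof.
apply/andP; split; first by apply: inf_image_ge => a; case/andP: (g01 a).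
by case: T0 => a; apply: le_trans (inf_image_lb a) _; case/andP: (g01 a).
Qed.

Lemma sup_image_adherent e : 0 < e ->
  exists a, sup [set g a | a in [set: T]] - e < g a.
Proof.
move=> e0; have : has_sup [set g a | a in [set: T]].
  split; first by case: T0 => a; exists (g a), a.
  by exists 1 => _ [b _ <-]; case/andP: (g01 b).
by move=> /(sup_adherent e0)[_ [a _ <-]]; exists a.
Qed.

Lemma inf_image_adherent e : 0 < e ->
  exists a, g a < inf [set g a | a in [set: T]] + e.
Proof.
move=> e0; have : has_inf [set g a | a in [set: T]].
  split; first by case: T0 => a; exists (g a), a.
  by exists 0 => _ [b _ <-]; case/andP: (g01 b).
by move=> /(inf_adherent e0)[_ [a _ <-]]; exists a.
Qed.

End UnitSup.

Lemma sup_image_dist (R : realType) (T : Type) (f g : T -> R) e :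
  inhabited T -> (forall a, 0 <= f a <= 1) -> (forall a, 0 <= g a <= 1) ->
  (forall a, `|f a - g a| <= e) ->
  `|sup [set f a | a in [set: T]] - sup [set g a | a in [set: T]]| <= e.
Proof.
move=> T0 f01 g01 fg.
suff H : forall (f g : T -> R), (forall a, 0 <= f a <= 1) ->
    (forall a, 0 <= g a <= 1) -> (forall a, `|f a - g a| <= e) ->
    sup [set f a | a in [set: T]] <= sup [set g a | a in [set: T]] + e.
  rewrite ler_norml; apply/andP; split; last by rewrite lerBlDl H.
  by rewrite lerNl opprB lerBlDl H // => a; rewrite distrC.
move=> {fg f01 g01} {}f {}g f01 g01 fg; apply: sup_image_le => // a.
apply: le_trans (_ : g a + e <= _); last by rewrite lerD2r sup_image_ub.
by rewrite -lerBlDl; apply: le_trans (fg a); rewrite ler_norm.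
Qed.

Lemma inf_image_dist (R : realType) (T : Type) (f g : T -> R) e :
  inhabited T -> (forall a, 0 <= f a <= 1) -> (forall a, 0 <= g a <= 1) ->
  (forall a, `|f a - g a| <= e) ->
  `|inf [set f a | a in [set: T]] - inf [set g a | a in [set: T]]| <= e.
Proof.
move=> T0 f01 g01 fg.
suff H : forall (f g : T -> R), (forall a, 0 <= f a <= 1) ->
    (forall a, 0 <= g a <= 1) -> (forall a, `|f a - g a| <= e) ->
    inf [set f a | a in [set: T]] <= inf [set g a | a in [set: T]] + e.
  rewrite ler_norml; apply/andP; split; last by rewrite lerBlDl H.
  by rewrite lerNl opprB lerBlDl H // => a; rewrite distrC.
move=> {fg f01 g01} {}f {}g f01 g01 fg; rewrite -lerBlDr; apply: inf_image_ge => // a.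
rewrite lerBlDr; apply: le_trans (inf_image_lb f01 a) _.
by rewrite -lerBlDl; apply: le_trans (fg a); rewrite ler_norm.
Qed.

Lemma compact_unit_cube (R : realType) n : compact (@unit_cube R n).
Proof.
have := @rV_compact R n (fun=> `[0, 1]%classic) (fun=> @segment_compact R 0 1).
congr compact; rewrite /unit_cube; apply/seteqP; split => v vc i;
  by have := vc i; rewrite /= in_itv.
Qed.

(** Heine-Cantor on the compact cube. In the near-covering form of compactness the parameter is the
    radius [delta], tending to 0 from the right; halving the local radius [r] keeps both points in
    the ball where [c] is close to [c x]. *)
Lemma connective_unif_continuous (R : realType) n (c : connective R n) e :
  0 < e -> exists2 delta, 0 < delta & forall x y : 'rV[R]_n,
    unit_cube x -> unit_cube y -> (forall i, `|x ord0 i - y ord0 i| < delta) ->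
    `|c x - c y| <= e.
Proof.
move=> e0.
have /compact_near_coveringP cov := @compact_unit_cube R n.
have /subspace_continuousP cc := @conn_continuous _ _ c.
have e20 : 0 < e / 2 by rewrite divr_gt0.
pose P (delta : R) (x : 'rV[R]_n) := forall y, unit_cube x -> unit_cube y ->
  (forall i, `|x ord0 i - y ord0 i| < delta) -> `|c x - c y| <= e.
have := cov R (0^'+) P _.
case.
  move=> x xc; have /cvgrPdist_lt /(_ _ e20) := cc x xc.
  rewrite near_withinE => /nbhs_ballP[r /= r0 rP].
  have r20 : 0 < r / 2 by rewrite divr_gt0.
  exists (ball x (r / 2), [set d | d < r / 2]) => /=.
    split; first exact: nbhsx_ballx.
    exact: nbhs_right_lt.
  move=> [x' d] /= [xx' dr] y x'c yc x'y.
  have bx' : ball x r x'.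
    by apply: le_ball xx'; rewrite ler_pdivrMr// ler_pMr// ler1n.
  have by' : ball x r y.
    rewrite (splitr r); apply: ball_triangle xx' _; split=> // i j.
    rewrite [i]ord1; rewrite /ball /=; apply: lt_trans dr; exact: x'y.
  have h1 := rP _ bx' x'c; have h2 := rP _ by' yc.
  rewrite -(subrKA (c x)) (splitr e); apply: le_trans (ler_normD _ _) _.
  by apply: lerD; apply: ltW => //; rewrite distrC.
move=> r /= r0 rP.
have r20 : 0 < r / 2 by rewrite divr_gt0.
exists (r / 2) => // x y xc yc xy.
apply: (rP (r / 2)) => //=.
by rewrite sub0r normrN gtr0_norm // ltr_pdivrMr// ltr_pMr// ltr1n.
Qed.

Section UltraLimit.
Variables (R : realType) (I : Type) (D : ultrafilter I).
Local Notation Ds := (ultrafilter_sets D).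
Implicit Types g h : I -> R.

#[local] Instance ultrafilter_proper : ProperFilter Ds.
Proof. exact: (@ultra_proper _ _ (ultrafilterP D)). Qed.

Lemma ultra_cvg g : (forall t, 0 <= g t <= 1) ->
  g x @[x --> Ds] --> lim (g x @[x --> Ds]).
Proof.
move=> g01; have gD : UltraFilter (g x @[x --> Ds]).
  split; first exact: fmap_proper_filter.
  move=> G PG gG; rewrite eqEsubset; split; last exact: gG.
  move=> B GB; case: (in_ultra_setVsetC (g @^-1` B) (ultrafilterP D)) => // nB.
  have GC : G (~` B) by exact: gG.
  have : G set0 by rewrite -(setICr B); exact: filterI.
  by move/filter_not_empty.
have := @segment_compact R 0 1.
rewrite compact_ultra => /(_ _ gD)[].
  by apply: (@filterE _ Ds) => t; rewrite /= in_itv /= g01.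
by move=> l [_ gl]; rewrite (cvg_lim _ gl).
Qed.

Lemma eq_ultra_lim g h : g =1 h -> lim (g x @[x --> Ds]) = lim (h x @[x --> Ds]).
Proof. by move=> /funext ->. Qed.

Lemma ultra_is_cvg g : (forall t, 0 <= g t <= 1) -> cvg (g x @[x --> Ds]).
Proof. by move=> /ultra_cvg gl; apply/cvg_ex; eexists; exact: gl. Qed.

Lemma ultra_lim_le g c : (forall t, 0 <= g t <= 1) ->
  (\forall t \near Ds, g t <= c) -> lim (g x @[x --> Ds]) <= c.
Proof. by move=> /ultra_is_cvg gl gc; apply: limr_le. Qed.

Lemma ultra_lim_lt g c : (forall t, 0 <= g t <= 1) ->
  lim (g x @[x --> Ds]) < c -> \forall t \near Ds, g t < c.
Proof. by move=> /ultra_cvg gl; apply: cvgr_lt. Qed.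

Lemma ultra_ler_lim g h e : (forall t, 0 <= g t <= 1) ->
  (forall t, 0 <= h t <= 1) -> (\forall t \near Ds, g t <= h t + e) ->
  lim (g x @[x --> Ds]) <= lim (h x @[x --> Ds]) + e.
Proof.
move=> g01 h01 gh; apply/ler_addgt0Pr => r r0; apply: ultra_lim_le => //.
have : lim (h x @[x --> Ds]) < lim (h x @[x --> Ds]) + r by rewrite ltrDl.
move=> /(ultra_lim_lt h01); apply: filterS2 gh => t ght hr.
by rewrite addrAC; apply: le_trans ght _; rewrite lerD2r ltW.
Qed.

(** Quantifier step of the theorem of Los. For the nontrivial inequality, points that are optimal up
    to [e] are chosen at each coordinate; together they form one element of [I -> M]. *)
Lemma ultra_lim_sup (M : Type) (g : M -> I -> R) : inhabited M ->
  (forall a t, 0 <= g a t <= 1) ->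
  sup [set lim (g (a x) x @[x --> Ds]) | a in [set: I -> M]] =
  lim (sup [set g a x | a in [set: M]] @[x --> Ds]).
Proof.
move=> M0 g01.
have s01 t : 0 <= sup [set g a t | a in [set: M]] <= 1 by exact: sup_image_01.
have l01 (a : I -> M) : 0 <= lim (g (a x) x @[x --> Ds]) <= 1.
  by apply: ultra_lim_01 => t.
apply/eqP; rewrite eq_le; apply/andP; split.
  apply: sup_image_le; first by case: M0 => a; exact: (inhabits (fun=> a)).
  move=> a; rewrite -[leRHS]addr0; apply: ultra_ler_lim => //.
  by apply: filterE => t; rewrite addr0; apply: (sup_image_ub (g := fun a => g a t)).
apply/ler_addgt0Pr => e e0.
have /choice[a aP] (t : I) :=
  sup_image_adherent (g := fun a => g a t) (fun a => g01 a t) M0 e0.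
have h : lim (g (a x) x @[x --> Ds]) <=
    sup [set lim (g (a x) x @[x --> Ds]) | a in [set: I -> M]].
  exact: (sup_image_ub (g := fun a : I -> M => lim (g (a x) x @[x --> Ds]))).
apply: le_trans (lerD h (lexx e)).
apply: ultra_ler_lim => //.
by apply: (@filterE _ Ds) => t /=; rewrite -lerBlDr ltW.
Qed.

Lemma ultra_lim_inf (M : Type) (g : M -> I -> R) : inhabited M ->
  (forall a t, 0 <= g a t <= 1) ->
  inf [set lim (g (a x) x @[x --> Ds]) | a in [set: I -> M]] =
  lim (inf [set g a x | a in [set: M]] @[x --> Ds]).
Proof.
move=> M0 g01.
have s01 t : 0 <= inf [set g a t | a in [set: M]] <= 1 by exact: inf_image_01.
have l01 (a : I -> M) : 0 <= lim (g (a x) x @[x --> Ds]) <= 1.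
  by apply: ultra_lim_01 => t.
apply/eqP; rewrite eq_le; apply/andP; split; last first.
  apply: inf_image_ge; first by case: M0 => a; exact: (inhabits (fun=> a)).
  move=> a; rewrite -[leRHS]addr0; apply: ultra_ler_lim => //.
  by apply: filterE => t; rewrite addr0; apply: (inf_image_lb (g := fun a => g a t)).
apply/ler_addgt0Pr => e e0.
have /choice[a aP] (t : I) :=
  inf_image_adherent (g := fun a => g a t) (fun a => g01 a t) M0 e0.
have h : inf [set lim (g (a x) x @[x --> Ds]) | a in [set: I -> M]] <=
    lim (g (a x) x @[x --> Ds]).
  exact: (inf_image_lb (g := fun a : I -> M => lim (g (a x) x @[x --> Ds]))).
apply: le_trans h _.
apply: ultra_ler_lim => //.
by apply: (@filterE _ Ds) => t /=; rewrite ltW.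
Qed.

Lemma ultra_lim_conn n (c : connective R n) (g : 'I_n -> I -> R) :
  (forall i t, 0 <= g i t <= 1) ->
  c (\row_i lim (g i x @[x --> Ds])) = lim (c (\row_i g i x) @[x --> Ds]).
Proof.
move=> g01; apply/esym/cvg_lim => //; apply/cvgrPdist_le => e e0.
have [d d0 dP] := connective_unif_continuous c e0.
have : \forall t \near Ds, forall i, `|lim (g i x @[x --> Ds]) - g i t| < d.
  apply: filter_forall => i; have /cvgrPdist_lt := ultra_cvg (g01 i).
  exact.
apply: filterS => t gt; apply: dP => [i|i|i]; rewrite ?mxE //.
exact: ultra_lim_01.
Qed.

End UltraLimit.

(** * Atomic formulas and the distance they define *)

Section Semantics.
Variables (R : realType) (L : language).
Implicit Types (M : structure R L) (t : term L).

Lemma value_01 M (phi : formula R L) (s : nat -> M) : 0 <= value s phi <= 1.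
Proof.
elim: phi s => [p ts|n c psi IH|x psi IH|x psi IH] s /=; first exact: pinterp_01.
- by apply: conn_01 => i; rewrite mxE.
- by apply: sup_image_01 => //; exact: universe_inhabited.
- by apply: inf_image_01 => //; exact: universe_inhabited.
Qed.

Fixpoint tsubst (sigma : nat -> term L) t : term L :=
  match t with
  | Var x => sigma x
  | Cst c => Cst c
  | App f ts => App f (fun i => tsubst sigma (ts i))
  end.

Lemma teval_tsubst M (s : nat -> M) sigma t :
  teval s (tsubst sigma t) = teval (fun x => teval s (sigma x)) t.
Proof.
by elim: t => //= f ts IH; congr finterp; apply/funext => i.
Qed.

Lemma occurs_tsubst x sigma t :
  occurs x (tsubst sigma t) -> exists2 y, occurs y t & occurs x (sigma y).
Proof.
elim: t => //= [y xy|f ts IH [i /IH[y yt xy]]]; first by exists y.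
by exists y => //; exists i.
Qed.

Lemma teval_eq M (s s' : nat -> M) t :
  (forall x, occurs x t -> s x = s' x) -> teval s t = teval s' t.
Proof.
elim: t => /= [x|c|f ts IH] ss' //; first exact: ss'.
by congr finterp; apply/funext => i; apply: IH => x xt; apply: ss'; exists i.
Qed.

Fixpoint tbound t : nat :=
  match t with
  | Var x => x.+1
  | Cst _ => 0
  | App f ts => \max_i tbound (ts i)
  end.

Lemma occurs_tbound x t : occurs x t -> (x < tbound t)%N.
Proof.
elim: t => //= [y ->//|f ts IH [i /IH xi]].
by apply: leq_trans xi _; apply: (leq_bigmax i).
Qed.

Definition atom := {p : psymb L & 'I_(parity p) -> term L}.
Implicit Types q : atom.

Definition aval M (s : nat -> M) q : R := pinterp (fun i => teval s (tagged q i)).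

Definition abound q : nat := \max_i tbound (tagged q i).

Lemma aval_01 M (s : nat -> M) q : 0 <= aval s q <= 1.
Proof. exact: pinterp_01. Qed.

Lemma aval_eq M (s s' : nat -> M) q :
  (forall x, (x < abound q)%N -> s x = s' x) -> aval s q = aval s' q.
Proof.
move=> ss'; congr pinterp; apply/funext => i; apply: teval_eq => x /occurs_tbound xi.
by apply: ss'; apply: leq_trans xi _; apply: (leq_bigmax i).
Qed.

Definition asubst (sigma : nat -> term L) q : atom :=
  existT _ (tag q) (fun i => tsubst sigma (tagged q i)).

Lemma aval_asubst M (s : nat -> M) sigma q :
  aval s (asubst sigma q) = aval (fun x => teval s (sigma x)) q.
Proof. by congr pinterp; apply/funext => i; rewrite teval_tsubst. Qed.

(* With [app_subst f y] and [tuple_assign x u], the arguments of f become the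
   first variables, and the other variables are shifted past them. *)
Definition app_subst (f : fsymb L) y z : term L :=
  if z == y then App f (fun i => Var (val i)) else Var (farity f + z).

Definition tuple_assign (T : Type) n (x : 'I_n -> T) (u : nat -> T) z : T :=
  if insub z is Some i then x i else u (z - n)%N.

(** Substituting a value of [f] into an atomic formula again gives an atomic formula, so the
    variation of atomic formulas controls function symbols as well. *)
Lemma aval_app_subst M (f : fsymb L) y (x : 'I_(farity f) -> M) u q :
  aval (tuple_assign x u) (asubst (app_subst f y) q) = aval (update u y (finterp x)) q.
Proof.
rewrite aval_asubst; congr aval; apply/funext => z; rewrite /app_subst /update.
case: eqP => _ /=; last first.
  by rewrite /tuple_assign insubF ?addKn// ltnNge leq_addr.
by congr finterp; apply/funext => i; rewrite /tuple_assign valK.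
Qed.

Lemma update_id M (s : nat -> M) x : update s x (s x) = s.
Proof. by apply/funext => y; rewrite /update; case: eqP => // ->. Qed.

Lemma normB_01 (u v : R) : 0 <= u <= 1 -> 0 <= v <= 1 -> 0 <= `|u - v| <= 1.
Proof.
by move=> /andP[u0 u1] /andP[v0 v1]; rewrite normr_ge0 ler_norml; lra.
Qed.

Section Rho.
Variable M : structure R L.
Implicit Types (s : nat -> M) (a b c : M).

Definition rho q x a b : R :=
  sup [set `|aval (update s x a) q - aval (update s x b) q|
      | s in [set: nat -> M]].

Let rho_arg_01 q x a b s : 0 <= `|aval (update s x a) q - aval (update s x b) q| <= 1.
Proof. by apply: normB_01; exact: aval_01. Qed.

Let assignment_inhabited : inhabited (nat -> M).
Proof. by case: (universe_inhabited M) => a; exact: (inhabits (fun=> a)). Qed.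

Lemma rho_ub q x a b s : `|aval (update s x a) q - aval (update s x b) q| <= rho q x a b.
Proof.
exact: (sup_image_ub
  (g := fun s => `|aval (update s x a) q - aval (update s x b) q|)).
Qed.

Lemma rho_le q x a b e :
  (forall s, `|aval (update s x a) q - aval (update s x b) q| <= e) ->
  rho q x a b <= e.
Proof. exact: sup_image_le. Qed.

Lemma rho_01 q x a b : 0 <= rho q x a b <= 1.
Proof. exact: sup_image_01. Qed.

Lemma rho_refl q x a : rho q x a a = 0.
Proof.
apply/eqP; rewrite eq_le; case/andP: (rho_01 q x a a) => -> _; rewrite andbT.
by apply: rho_le => s; rewrite subrr normr0.
Qed.

Lemma rho_sym q x a b : rho q x a b = rho q x b a.
Proof. by congr sup; apply: eq_imagel => s _; rewrite distrC. Qed.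

Lemma rho_triangle q x a b c : rho q x a c <= rho q x a b + rho q x b c.
Proof.
apply: rho_le => s; rewrite -(subrKA (aval (update s x b) q)).
by apply: le_trans (ler_normD _ _) _; apply: lerD; exact: rho_ub.
Qed.

(* Replace the variables of q one at a time. *)
Lemma aval_dist q s s' :
  `|aval s q - aval s' q| <= \sum_(x < abound q) rho q x (s x) (s' x).
Proof.
pose h k x := if (x < k)%N then s' x else s x.
have -> : aval s' q = aval (h (abound q)) q.
  by apply: aval_eq => x xq; rewrite /h xq.
elim: (abound q) => [|k IH].
  by rewrite big_ord0 (_ : h 0 = s) ?subrr ?normr0//; apply/funext.
rewrite big_ord_recr /= -(subrKA (aval (h k) q)).
apply: le_trans (ler_normD _ _) _; apply: lerD => //.
have <- : update (h k) k (s k) = h k.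
  rewrite -[RHS](update_id _ k); congr update.
  by rewrite /h ltnn.
suff -> : h k.+1 = update (h k) k (s' k) by exact: rho_ub.
apply/funext => x; rewrite /update /h ltnS leq_eqVlt.
by case: eqP => [->|].
Qed.

End Rho.
End Semantics.

Lemma expr_half_gt0 (R : realType) k : 0 < (2^-1 : R) ^+ k.
Proof. by rewrite exprn_gt0// invr_gt0. Qed.

Lemma expr_half_le (R : realType) m n : (m <= n)%N -> (2^-1 : R) ^+ n <= 2^-1 ^+ m.
Proof.
by apply: ler_wiXn2l; rewrite ?invr_ge0// invf_le1// ler1n.
Qed.

Lemma expr_half_small (R : realType) (e : R) : 0 < e -> exists n, 2^-1 ^+ n <= e.
Proof.
move=> e0; have h : `|2^-1 : R| < 1 by rewrite gtr0_norm ?invr_gt0// invf_lt1// ltr1n.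
have /cvgrPdist_le /(_ _ e0)[n _ /(_ n (leqnn n))] := cvg_expr h.
by rewrite sub0r normrN gtr0_norm ?expr_half_gt0//; exists n.
Qed.

Lemma finite_lower_bound (R : realType) (f : nat -> R) n : (forall k, 0 < f k) ->
  exists2 delta, 0 < delta & forall k, (k < n)%N -> delta <= f k.
Proof.
move=> f0; elim: n => [|n [d d0 df]]; first by exists 1.
exists (Num.min d (f n)); first by rewrite lt_min d0 f0.
move=> k; rewrite ltnS leq_eqVlt => /orP[/eqP->|/df dk].
  by rewrite ge_min lexx orbT.
by rewrite ge_min dk.
Qed.

Section Distance.
Variables (R : realType) (L : language) (al : nat -> option (atom L * nat)).
Local Notation w k := ((2^-1 : R) ^+ k).

Section Fixed.
Variable M : structure R L.
Implicit Types a b c : M.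

Definition orho k a b : R := if al k is Some qx then rho qx.1 qx.2 a b else 0.

(** Weighted maxima rather than sums: the values stay in [[0, 1]], each stage is one binary
    connective, and the terms from [n] on add at most [w n]. *)
Fixpoint dist_upto n a b : R :=
  if n is n'.+1 then Num.max (dist_upto n' a b) (w n' * orho n' a b) else 0.

Definition dist_all a b : R := sup [set dist_upto n a b | n in [set: nat]].

Lemma orho_01 k a b : 0 <= orho k a b <= 1.
Proof. by rewrite /orho; case: al => [qx|]; rewrite ?rho_01// lexx ler01. Qed.

Lemma worho_01 k a b : 0 <= w k * orho k a b <= w k.
Proof.
have /andP[h0 h1] := orho_01 k a b.
by rewrite mulr_ge0 ?(ltW (expr_half_gt0 _ _))//= ler_piMr ?(ltW (expr_half_gt0 _ _)).
Qed.

Lemma worho_le1 k a b : w k * orho k a b <= 1.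
Proof.
case/andP: (worho_01 k a b) => _ /le_trans; apply.
by rewrite -(expr0 (2^-1)); exact: expr_half_le.
Qed.

Lemma dist_upto_01 n a b : 0 <= dist_upto n a b <= 1.
Proof.
elim: n => [|n /andP[h0 h1]] /=; first by rewrite lexx ler01.
by rewrite le_max h0 /= ge_max h1 worho_le1.
Qed.

Lemma dist_upto_le n a b e : 0 <= e ->
  (forall k, (k < n)%N -> w k * orho k a b <= e) -> dist_upto n a b <= e.
Proof.
move=> e0; elim: n => //= n IH h; rewrite ge_max h// andbT.
by apply: IH => k kn; apply/h/ltnW.
Qed.

Lemma dist_upto_ge n k a b : (k < n)%N -> w k * orho k a b <= dist_upto n a b.
Proof.
elim: n => //= n IH; rewrite ltnS leq_eqVlt => /orP[/eqP->|/IH kn].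
  by rewrite le_max lexx orbT.
by rewrite le_max kn.
Qed.

Lemma dist_all_01 a b : 0 <= dist_all a b <= 1.
Proof. by apply: sup_image_01 => [n|]; [exact: dist_upto_01|exact: (inhabits 0%N)]. Qed.

Lemma dist_all_le a b e : 0 <= e ->
  (forall k, w k * orho k a b <= e) -> dist_all a b <= e.
Proof.
move=> e0 h; apply: sup_image_le; first exact: (inhabits 0%N).
by move=> n; apply: dist_upto_le.
Qed.

Lemma dist_upto_all n a b : dist_upto n a b <= dist_all a b.
Proof.
exact: (sup_image_ub (g := fun n => dist_upto n a b) (fun n => dist_upto_01 n a b)).
Qed.

Lemma dist_all_ge k a b : w k * orho k a b <= dist_all a b.
Proof. exact: le_trans (dist_upto_ge _ _ (ltnSn k)) (dist_upto_all _ _ _). Qed.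

Lemma dist_all_upto n a b : `|dist_all a b - dist_upto n a b| <= w n.
Proof.
rewrite ger0_norm ?subr_ge0 ?dist_upto_all// lerBlDl.
have /andP[d0 _] := dist_upto_01 n a b.
apply: dist_all_le => [|k]; first by rewrite addr_ge0// ltW// expr_half_gt0.
have [kn|nk] := ltnP k n.
  by apply: le_trans (dist_upto_ge _ _ kn) _; rewrite lerDl ltW// expr_half_gt0.
case/andP: (worho_01 k a b) => _ /le_trans; apply.
by apply: le_trans (expr_half_le R nk) _; rewrite lerDr.
Qed.

Lemma dist_all_refl a : dist_all a a = 0.
Proof.
apply/eqP; rewrite eq_le; case/andP: (dist_all_01 a a) => -> _; rewrite andbT.
apply: dist_all_le => // k; rewrite /orho.
by case: al => [[q x]|] /=; rewrite ?rho_refl mulr0.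
Qed.

Lemma dist_all_sym a b : dist_all a b = dist_all b a.
Proof.
suff h a' b' : dist_all a' b' <= dist_all b' a' by apply/eqP; rewrite eq_le !h.
apply: dist_all_le => [|k]; first by case/andP: (dist_all_01 b' a').
rewrite (_ : orho k a' b' = orho k b' a') ?dist_all_ge//.
by rewrite /orho; case: al => // qx; rewrite rho_sym.
Qed.

Lemma dist_all_triangle a b c : dist_all a c <= dist_all a b + dist_all b c.
Proof.
apply: dist_all_le => [|k].
  by apply: addr_ge0; [case/andP: (dist_all_01 a b)|case/andP: (dist_all_01 b c)].
apply: le_trans (lerD (dist_all_ge k a b) (dist_all_ge k b c)).
rewrite -mulrDr ler_wpM2l ?(ltW (expr_half_gt0 _ _))//.
by rewrite /orho; case: al => [qx|]; rewrite ?rho_triangle// addr0.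
Qed.

Hypothesis al_surj : forall q x, exists k, al k = Some (q, x).

Lemma aval_unif_continuous (q : atom L) e : 0 < e ->
  exists2 delta, 0 < delta & forall s s' : nat -> M,
    (forall x, (x < abound q)%N -> dist_all (s x) (s' x) < delta) ->
    `|aval s q - aval s' q| <= e.
Proof.
move=> e0; have /choice[k kP] : forall x, exists k, al k = Some (q, x) by [].
pose r := abound q; have r0 : 0 < (r.+1%:R : R) by rewrite ltr0n.
(* At distance below [w (k x) * (e / r.+1)] the variable [x] changes [q] by at most [e / r.+1], and
   only [r] variables contribute. The successor keeps the divisor nonzero when [r = 0]. *)
have f0 x : 0 < w (k x) * (e / r.+1%:R) by rewrite !mulr_gt0 ?invr_gt0 ?expr_half_gt0.
have [d d0 dP] := finite_lower_bound r f0.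
exists d => // s s' ss'; apply: le_trans (aval_dist q s s') _.
apply: (@le_trans _ _ (\sum_(x < r) (e / r.+1%:R))).
  apply: ler_sum => x _; rewrite -(ler_pM2l (expr_half_gt0 R (k x))).
  apply: le_trans (dP x (ltn_ord x)).
  apply: le_trans (ltW (ss' x (ltn_ord x))).
  by have := dist_all_ge (k x) (s x) (s' x); rewrite /orho kP.
rewrite sumr_const card_ord -[leLHS]mulr_natr -mulrA ler_piMr ?(ltW e0)//.
by rewrite mulrC ler_pdivrMr// mul1r ler_nat.
Qed.

(** Beyond an [n] with [w n <= e] the weights alone suffice, so finitely many [rho_k] matter. Each
    compares an atomic formula at two values of [f], which is a variation of that formula with [f]
    substituted into it; the extra variables [u] are the same on both sides. *)
Lemma finterp_unif_continuous (f : fsymb L) e : 0 < e ->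
  exists2 delta, 0 < delta & forall x y : 'I_(farity f) -> M,
    (forall i, dist_all (x i) (y i) < delta) ->
    dist_all (finterp x) (finterp y) <= e.
Proof.
move=> e0; have [n ne] := expr_half_small e0.
have /choice[delta dP] k : exists delta, 0 < delta /\ forall x y : 'I_(farity f) -> M,
    (forall i, dist_all (x i) (y i) < delta) -> orho k (finterp x) (finterp y) <= e.
  rewrite /orho; case: (al k) => [[q z]|]; last by exists 1; split=> // *; exact: ltW.
  have [d d0 dP] := aval_unif_continuous (asubst (app_subst f z) q) e0.
  exists d; split=> // x y xy; apply: rho_le => u /=.
  rewrite -!aval_app_subst; apply: dP => v _; rewrite /tuple_assign.
  by case: insubP => [i _ _|_]; rewrite ?dist_all_refl.
have [d d0 dmin] := finite_lower_bound n (fun k => proj1 (dP k)).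
exists d => // x y xy; apply: dist_all_le => [|k]; first exact: ltW.
have [kn|nk] := ltnP k n.
  have h : orho k (finterp x) (finterp y) <= e.
    by apply: (proj2 (dP k)) => i; apply: lt_le_trans (xy i) (dmin _ kn).
  apply: le_trans h; rewrite ler_piMl//; first by case/andP: (orho_01 k (finterp x) (finterp y)).
  by rewrite -(expr0 (2^-1)); exact: expr_half_le.
case/andP: (worho_01 k (finterp x) (finterp y)) => _ /le_trans; apply.
exact: le_trans (expr_half_le R nk) ne.
Qed.

Lemma pinterp_unif_continuous (p : psymb L) e : 0 < e ->
  exists2 delta, 0 < delta & forall x y : 'I_(parity p) -> M,
    (forall i, dist_all (x i) (y i) < delta) -> `|pinterp x - pinterp y| <= e.
Proof.
move=> e0.
pose q : atom L := existT _ p (fun i : 'I_(parity p) => Var (val i)).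
have [d d0 dP] := aval_unif_continuous q e0.
case: (universe_inhabited M) => m.
have tupE (x : 'I_(parity p) -> M) : aval (tuple_assign x (fun=> m)) q = pinterp x.
  by congr pinterp; apply/funext => i; rewrite /= /tuple_assign valK.
exists d => // x y xy; rewrite -!tupE; apply: dP => v _; rewrite /tuple_assign.
by case: insubP => [i _ _|_]; rewrite ?dist_all_refl.
Qed.

End Fixed.
End Distance.

(** * Reductions and the theorem of Los *)

Section Homomorphism.
Variables (R : realType) (L : language) (M N : structure R L) (h : M -> N).
Hypothesis h_surj : forall b, exists a, h a = b.
Hypothesis h_cinterp : forall c, h (cinterp M c) = cinterp N c.
Hypothesis h_finterp : forall (f : fsymb L) x,
  h (@finterp R L M f x) = finterp (fun i => h (x i)).
Hypothesis h_pinterp : forall (p : psymb L) (x : 'I_(parity p) -> M),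
  pinterp (fun i => h (x i)) = pinterp x.

Lemma teval_hom (s : nat -> M) t : teval (fun x => h (s x)) t = h (teval s t).
Proof.
elim: t => //= f ts IH; rewrite h_finterp; congr finterp.
exact/funext.
Qed.

Lemma update_hom (s : nat -> M) x a :
  update (fun x => h (s x)) x (h a) = (fun y => h (update s x a y)).
Proof. by apply/funext => y; rewrite /update; case: eqP. Qed.

(** Surjectivity serves the quantifiers. With [h := id] the lemma also identifies values in
    structures that differ only by casts of argument indices or by the way they are assembled. *)
Lemma value_hom (s : nat -> M) (phi : formula R L) :
  value (fun x => h (s x)) phi = value s phi.
Proof.
elim: phi s => [p ts|n c psi IH|x psi IH|x psi IH] s /=.
- rewrite -h_pinterp; congr pinterp; apply/funext => i; exact: teval_hom.
- by congr (conn_fun c _); apply/rowP => i; rewrite !mxE.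
- congr sup; apply/seteqP; split => _ [b _ <-].
    by have [a <-] := h_surj b; exists a => //; rewrite update_hom IH.
  by exists (h b) => //; rewrite update_hom IH.
- congr inf; apply/seteqP; split => _ [b _ <-].
    by have [a <-] := h_surj b; exists a => //; rewrite update_hom IH.
  by exists (h b) => //; rewrite update_hom IH.
Qed.

End Homomorphism.

Section Reduction.
Variables (R : realType) (L : language) (M : structure R L).
Implicit Types (a b : M) (s : nat -> M).

Lemma indistinguishable_rho q x a b : indistinguishable a b -> rho q x a b = 0.
Proof.
move=> ab; apply/eqP; rewrite eq_le; case/andP: (rho_01 q x a b) => -> _.
rewrite andbT; apply: rho_le => s.
by have := ab (tag q) (tagged q) x s; rewrite /= /aval => ->; rewrite subrr normr0.
Qed.

Lemma aval_indistinguishable s s' (q : atom L) :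
  (forall x, indistinguishable (s x) (s' x)) -> aval s q = aval s' q.
Proof.
move=> ss'; apply/eqP; rewrite -subr_eq0 -normr_le0.
apply: le_trans (aval_dist q s s') _; rewrite big1// => x _.
exact: indistinguishable_rho.
Qed.

Lemma finterp_indistinguishable (f : fsymb L) (x y : 'I_(farity f) -> M) :
  (forall i, indistinguishable (x i) (y i)) ->
  indistinguishable (finterp x) (finterp y).
Proof.
move=> xy p ts z s; pose q : atom L := existT _ p ts.
change (aval (update s z (finterp x)) q = aval (update s z (finterp y)) q).
rewrite -!aval_app_subst; apply: aval_indistinguishable => v.
by rewrite /tuple_assign; case: insubP => [i _ _|_].
Qed.

Lemma pinterp_indistinguishable (p : psymb L) (x y : 'I_(parity p) -> M) :
  (forall i, indistinguishable (x i) (y i)) -> pinterp x = pinterp y.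
Proof.
move=> xy; case: (universe_inhabited M) => m.
pose q : atom L := existT _ p (fun i : 'I_(parity p) => Var (val i)).
have tupE (x' : 'I_(parity p) -> M) : aval (tuple_assign x' (fun=> m)) q = pinterp x'.
  by congr pinterp; apply/funext => i; rewrite /= /tuple_assign valK.
rewrite -!tupE; apply: aval_indistinguishable => v; rewrite /tuple_assign.
by case: insubP => [i _ _|_].
Qed.

Definition reduce a : reduction M := \pi_{eq_quot indist M} (a : {classic M}).

Definition choose_rep (b : reduction M) : M := repr b.

Lemma choose_repK (b : reduction M) : reduce (choose_rep b) = b.
Proof. exact: reprK. Qed.

Lemma reduce_indistinguishable a b : reduce a = reduce b <-> indistinguishable a b.
Proof.
by split => [/eqmodP/asboolP|ab]; [|apply/eqmodP/asboolP].
Qed.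

Lemma choose_rep_reduce a : indistinguishable (choose_rep (reduce a)) a.
Proof. by apply/reduce_indistinguishable; rewrite choose_repK. Qed.

Lemma reduce_finterp (f : fsymb L) (x : 'I_(farity f) -> M) :
  reduce (finterp x) = finterp (fun i => reduce (x i)).
Proof.
apply/reduce_indistinguishable; apply: finterp_indistinguishable => i.
by move=> p t y s; rewrite choose_rep_reduce.
Qed.

Lemma reduce_pinterp (p : psymb L) (x : 'I_(parity p) -> M) :
  pinterp (fun i => reduce (x i)) = pinterp x.
Proof. by apply: pinterp_indistinguishable => i; exact: choose_rep_reduce. Qed.

Lemma reduce_surj (b : reduction M) : exists a, reduce a = b.
Proof. by exists (choose_rep b); exact: choose_repK. Qed.

End Reduction.

Lemma Th_reduction (R : realType) (L : language) (M : structure R L) :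
  Th (reduction M) = Th M.
Proof.
have H (s : nat -> M) (phi : formula R L) : value (fun x => reduce (s x)) phi = value s phi.
  by apply: (@value_hom _ _ M (reduction M) (@reduce _ _ M));
    [exact: reduce_surj| |exact: reduce_finterp|exact: reduce_pinterp].
apply/seteqP; split => phi [sphi v0]; split => // s.
  by rewrite -H.
rewrite (_ : s = fun x => reduce (choose_rep (s x))) ?H//.
by apply/funext => x; rewrite choose_repK.
Qed.

Section Los.
Variables (R : realType) (L : language) (M : structure R L).
Variables (I : Type) (D : ultrafilter I).
Local Notation P := (pre_ultrapower M D).
Local Notation Ds := (ultrafilter_sets D).

Lemma teval_pre_ultrapower (s : nat -> P) t k :
  teval s t k = teval (fun x => s x k) t.
Proof.
by elim: t => //= f ts IH; congr finterp; apply/funext => i.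
Qed.

Lemma update_pre_ultrapower (s : nat -> P) x (a : P) k :
  (fun y => update s x a y k) = update (fun y => s y k) x (a k).
Proof. by apply/funext => y; rewrite /update; case: eqP. Qed.

(** Stated for [I -> M] before the quotient, where coordinates can be read off; [Th_reduction]
    carries theories over to the quotient. *)
Theorem Los (s : nat -> P) (phi : formula R L) :
  value s phi = lim (value (fun x => s x k) phi @[k --> Ds]).
Proof.
elim: phi s => [p ts|n c psi IH|x psi IH|x psi IH] s /=.
- apply: eq_ultra_lim => k; congr pinterp; apply/funext => i.
  exact: teval_pre_ultrapower.
- rewrite -(ultra_lim_conn D c (g := fun i k => value (fun x => s x k) (psi i))).
    by congr (conn_fun c _); apply/rowP => i; rewrite !mxE IH.
  by move=> i k; exact: value_01.
- rewrite -(ultra_lim_sup D (g := fun a k => value (update (fun y => s y k) x a) psi)).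
  + congr sup; apply: eq_imagel => a _; rewrite IH; apply: eq_ultra_lim => k.
    by rewrite update_pre_ultrapower.
  + exact: universe_inhabited.
  + by move=> a k; exact: value_01.
- rewrite -(ultra_lim_inf D (g := fun a k => value (update (fun y => s y k) x a) psi)).
  + congr inf; apply: eq_imagel => a _; rewrite IH; apply: eq_ultra_lim => k.
    by rewrite update_pre_ultrapower.
  + exact: universe_inhabited.
  + by move=> a k; exact: value_01.
Qed.

Lemma Th_pre_ultrapower : Th P = Th M.
Proof.
apply/seteqP; split => phi [sphi v0]; split => // s.
  (* An assignment in [M] is read as one by constant sequences, on which the ultralimit is
     trivial. *)
  have := v0 (fun x => fun=> s x); rewrite Los => <-.
  by apply/esym/cvg_lim => //; exact: cvg_cst.
rewrite Los -[RHS](_ : lim ((fun=> 0 : R) k @[k --> Ds]) = 0).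
  by apply: eq_ultra_lim => k.
by apply: cvg_lim => //; exact: cvg_cst.
Qed.

End Los.

Definition ord0_elim (T : Type) (i : 'I_0) : T.
Proof. by case: i. Defined.

Lemma zero_connective_continuous (R : realType) n :
  {within @unit_cube R n, continuous (fun=> 0 : R)}.
Proof. by apply: continuous_subspaceT; exact: cst_continuous. Qed.

Lemma zero_connective_01 (R : realType) n (x : 'rV[R]_n) :
  unit_cube x -> 0 <= (0 : R) <= 1.
Proof. by rewrite lexx ler01. Qed.

(** [excess_formula] of [psi] against this formula has value 0 exactly when [psi <= e], which turns
    an estimate into a condition. *)
Definition zero_formula (R : realType) (L : language) : formula R L :=
  Conn 0 (Connective (@zero_connective_continuous R 0) (@zero_connective_01 R 0))
    (@ord0_elim _).

(** * Change of language and saturation *)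

Record lmap (L L' : language) := LMap {
  cmap : csymb L -> csymb L';
  fmap_symb : fsymb L -> fsymb L';
  pmap_symb : psymb L -> psymb L';
  farity_map : forall f, farity (fmap_symb f) = farity f;
  parity_map : forall p, parity (pmap_symb p) = parity p }.

Section LanguageMap.
Variables (R : realType) (L L' : language) (F : lmap L L').

Fixpoint tmap (t : term L) : term L' :=
  match t with
  | Var x => Var x
  | Cst c => Cst (cmap F c)
  | App f ts =>
      App (fmap_symb F f) (fun i => tmap (ts (cast_ord (farity_map F f) i)))
  end.

Definition amap (q : atom L) : atom L' :=
  existT _ (pmap_symb F (tag q))
    (fun i => tmap (tagged q (cast_ord (parity_map F (tag q)) i))).

Fixpoint phmap (phi : formula R L) : formula R L' :=
  match phi with
  | Atom p ts =>
      Atom (pmap_symb F p) (fun i => tmap (ts (cast_ord (parity_map F p) i)))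
  | Conn n c psi => Conn n c (fun i => phmap (psi i))
  | Sup x psi => Sup x (phmap psi)
  | Inf x psi => Inf x (phmap psi)
  end.

Definition reduct (N : structure R L') : structure R L :=
  @Structure R L N (universe_inhabited N) (fun c => cinterp N (cmap F c))
    (fun f x =>
       finterp (f := fmap_symb F f) (fun i => x (cast_ord (farity_map F f) i)))
    (fun p x =>
       pinterp (p := pmap_symb F p) (fun i => x (cast_ord (parity_map F p) i)))
    (fun p x => pinterp_01 _).

Lemma occurs_tmap x t : occurs x (tmap t) -> occurs x t.
Proof. by elim: t => //= f ts IH [i /IH]; exists (cast_ord (farity_map F f) i). Qed.

Lemma free_phmap x phi : Defs.free x (phmap phi) -> Defs.free x phi.
Proof.
elim: phi => [p ts [i /occurs_tmap]|n c psi IH [i /IH]|y psi IH [xy /IH]|y psi IH [xy /IH]] //=.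
  by exists (cast_ord (parity_map F p) i).
by exists i.
Qed.

Lemma sentence_phmap phi : sentence phi -> sentence (phmap phi).
Proof. by move=> sphi x /free_phmap /sphi. Qed.

Variable N : structure R L'.

Lemma teval_tmap (s : nat -> N) t : teval s (tmap t) = teval (M := reduct N) s t.
Proof. by elim: t => //= f ts IH; congr finterp; apply/funext => i. Qed.

Lemma aval_amap (s : nat -> N) q : aval s (amap q) = aval (M := reduct N) s q.
Proof. by congr pinterp; apply/funext => i; exact: teval_tmap. Qed.

Lemma value_phmap (s : nat -> N) phi : value s (phmap phi) = value (M := reduct N) s phi.
Proof.
elim: phi s => [p ts|n c psi IH|x psi IH|x psi IH] s /=.
- by congr pinterp; apply/funext => i; exact: teval_tmap.
- by congr (conn_fun c _); apply/rowP => i; rewrite !mxE.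
- by congr sup; apply: eq_imagel => a _.
- by congr inf; apply: eq_imagel => a _.
Qed.

End LanguageMap.

Section Saturation.
Variable R : realType.

Definition expand_by (L : language) (M : structure R L) (C : Type) (c : C -> M) :
    structure R (add_constants L C) :=
  @Structure R (add_constants L C) M (universe_inhabited M)
    (fun x => match x with inl x => cinterp M x | inr i => c i end)
    (@finterp R L M) (@pinterp R L M) (@pinterp_01 R L M).

(* Saturation with parameters named by I rather than by a subset of M, so that the
   language of the conditions does not depend on M; names may coincide. *)
Definition indexed_saturated (I : Type) (L : language) (M : structure R L) : Prop :=
  forall (c : I -> M) (G : set (formula R (add_constants L I))),
  finitely_satisfiable (expand_by c) G -> satisfiable (expand_by c) G.

(** A finite part of [G2] follows, along [w], from finitely many members of [G1]. The asymmetry is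
    deliberate: a condition of [G2] must follow from a single one of [G1], while one of [G1] may use
    all of [G2], as happens when an exact condition is replaced by its approximations. *)
Lemma satisfiable_transfer (L1 L2 : language) (M1 : structure R L1)
    (M2 : structure R L2) (G1 : set (formula R L1)) (G2 : set (formula R L2))
    (w : (nat -> M1) -> nat -> M2) (w' : (nat -> M2) -> nat -> M1) :
  (forall phi2, G2 phi2 -> exists2 phi1, G1 phi1 &
     forall s, value s phi1 = 0 -> value (w s) phi2 = 0) ->
  (forall s, (forall phi2, G2 phi2 -> value s phi2 = 0) ->
     forall phi1, G1 phi1 -> value (w' s) phi1 = 0) ->
  (finitely_satisfiable M2 G2 -> satisfiable M2 G2) ->
  finitely_satisfiable M1 G1 -> satisfiable M1 G1.
Proof.
move=> G21 G12 sat2 fin1.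
have [s sG] : satisfiable M2 G2; last by exists (w' s) => phi; exact: G12.
apply: sat2 => F2 F2G F2fin.
have /choice[g gP] : forall phi2, exists phi1, G2 phi2 -> G1 phi1 /\
    forall s : nat -> M1, value s phi1 = 0 -> value (w s) phi2 = 0.
  move=> phi2; have [/G21[phi1 G1phi h]|nG] := pselect (G2 phi2).
    by exists phi1.
  by exists (zero_formula R L1).
have [s sF] : satisfiable M1 (g @` F2).
  apply: fin1; last exact: finite_image.
  by move=> _ [phi2 /F2G/gP[h _] <-].
exists (w s) => phi2 F2phi; apply: (proj2 (gP _ (F2G _ F2phi))).
by apply: sF; exists phi2.
Qed.

Definition constant_lmap (L : language) (C C' : Type) (h : C -> C') :
    lmap (add_constants L C) (add_constants L C') :=
  @LMap (add_constants L C) (add_constants L C')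
    (fun x => match x with inl x => inl x | inr i => inr (h i) end) id id
    (fun=> erefl) (fun=> erefl).

Lemma value_constant_lmap (L : language) (M : structure R L) (C C' : Type)
    (h : C -> C') (c : C -> M) (c' : C' -> M) (s : nat -> M) phi :
  (forall i, c' (h i) = c i) ->
  value (M := expand_by c') s (phmap (constant_lmap L h) phi) =
  value (M := expand_by c) s phi.
Proof.
move=> cc'; rewrite value_phmap.
apply: (@value_hom _ _ (expand_by c) (reduct _ (expand_by c')) id).
- by move=> b; exists b.
- by case=> //= i; rewrite cc'.
- by move=> f x /=; congr (@finterp R L M f _); apply/funext => i; rewrite cast_ord_id.
- by move=> p x /=; congr (@pinterp R L M p _); apply/funext => i; rewrite cast_ord_id.
Qed.

Lemma satisfiable_constant_lmap (L : language) (M : structure R L) (C C' : Type)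
    (h : C -> C') (c : C -> M) (c' : C' -> M) G :
  (forall i, c' (h i) = c i) ->
  (forall G', finitely_satisfiable (expand_by c') G' -> satisfiable (expand_by c') G') ->
  finitely_satisfiable (expand_by c) G -> satisfiable (expand_by c) G.
Proof.
move=> cc' sat'.
apply: (@satisfiable_transfer _ _ (expand_by c) (expand_by c') G
  (phmap (constant_lmap L h) @` G) id id) => //.
- by move=> _ [phi Gphi <-]; exists phi => // s; rewrite (value_constant_lmap _ _ cc').
- move=> s sG phi Gphi; rewrite -(value_constant_lmap _ _ cc').
  by apply: sG; exists phi.
- exact: sat'.
Qed.

(** Names may be repeated or wasted: [range c] is an image of [I], and conversely an injection of
    [A] into [I] names the parameters, the remaining names denoting an arbitrary [m]. *)
Lemma succ_saturated_indexed (I : Type) (L : language) (M : structure R L) :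
  succ_saturated I M <-> indexed_saturated I M.
Proof.
split=> [sat c G|sat A /card_leP[h] G].
  apply: (@satisfiable_constant_lmap L M I (range c)
    (fun i => SigSub (mem_set (imageT c i))) c val) => // G'.
  by apply: sat; exact: card_image_le.
pose k (a : A) : I := val (h a).
have k_inj : injective k.
  by move=> a b /val_inj; apply: (@inj _ _ _ h); rewrite in_setT.
case: (universe_inhabited M) => m.
have /choice[c cP] (i : I) : exists b : M, forall a : A, k a = i -> b = val a.
  have [[a <-]|no] := pselect (exists a, k a = i).
    by exists (val a) => b /k_inj ->.
  by exists m => a ai; case: no; exists a.
apply: (@satisfiable_constant_lmap L M A I k val c).
  by move=> a; apply: cP.
by move=> G'; exact: sat.
Qed.

Lemma value_reduce_expand (L : language) (M : structure R L) (C : Type) (c : C -> M)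
    (s : nat -> M) (phi : formula R (add_constants L C)) :
  value (M := expand_by (fun i => reduce (c i))) (fun x => reduce (s x)) phi =
  value (M := expand_by c) s phi.
Proof.
apply: (@value_hom _ _ (expand_by c) (expand_by (fun i => reduce (c i))) (@reduce _ _ M)).
- exact: reduce_surj.
- by case.
- by move=> f x; exact: (@reduce_finterp R L M f x).
- by move=> p x; exact: (@reduce_pinterp R L M p x).
Qed.

Lemma indexed_saturated_reduction (I : Type) (L : language) (M : structure R L) :
  indexed_saturated I (reduction M) <-> indexed_saturated I M.
Proof.
have repE (s : nat -> reduction M) : (fun x => reduce (choose_rep (s x))) = s.
  by apply/funext => x; rewrite choose_repK.
split=> sat c G.
  apply: (@satisfiable_transfer _ _ (expand_by c) (expand_by (fun i => reduce (c i))) G G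
    (fun s x => @reduce R L M (s x)) (fun s x => @choose_rep R L M (s x))).
  - by move=> phi Gphi; exists phi => // s; rewrite value_reduce_expand.
  - by move=> s sG phi Gphi; rewrite -value_reduce_expand repE; exact: sG.
  - exact: sat.
have cE : c = fun i => reduce (choose_rep (c i)) by apply/funext => i; rewrite choose_repK.
apply: (@satisfiable_transfer _ _ (expand_by c) (expand_by (fun i => choose_rep (c i))) G G
    (fun s x => @choose_rep R L M (s x)) (fun s x => @reduce R L M (s x))).
- move=> phi Gphi; exists phi => // s s0.
  by rewrite -value_reduce_expand -cE repE.
- by move=> s sG phi Gphi; rewrite cE value_reduce_expand; exact: sG.
- exact: sat.
Qed.

(** Removes the quotient from the question. The quotients for a language and for its expansion by
    [d] are different types, whereas the functions [I -> M] are the same for both. *)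
Lemma saturates_indexed (L : language) (I : Type) (D : ultrafilter I) (M : structure R L) :
  saturates D M <-> indexed_saturated I (pre_ultrapower M D).
Proof.
by rewrite /saturates succ_saturated_indexed indexed_saturated_reduction.
Qed.

End Saturation.

(** * Formulas approximating the distance *)

Section BinaryConnective.
Variable R : realType.

Lemma coord_within (i : 'I_2) :
  continuous (fun v : 'rV[R]_2 => v ord0 i).
Proof. exact: coord_continuous. Qed.

(** Vanishes exactly when the two coordinates are within [e], which lets a formula of value 0
    express approximate equality. For [e = 0] it is the absolute difference, as in the body of
    [rho]. *)
Definition excess_fun (e : R) (v : 'rV[R]_2) : R :=
  Num.max 0 (`|v ord0 ord0 - v ord0 ord_max| - e).

Lemma excess_continuous e : {within @unit_cube R 2, continuous (excess_fun e)}.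
Proof.
apply: continuous_subspaceT => v.
have FF : Filter (nbhs v) := nbhs_filter v.
have c2 := cvg_norm (cvgB (@coord_within ord0 v) (@coord_within ord_max v)).
have c3 := cvgB (c2 FF FF) (@cvg_cst _ e _ (nbhs v) FF).
exact: (continuous_max (@cst_continuous _ _ (0 : R^o) v) (c3 FF)).
Qed.

Lemma excess_01 e (e0 : 0 <= e) (v : 'rV[R]_2) :
  unit_cube v -> 0 <= excess_fun e v <= 1.
Proof.
move=> vc; rewrite /excess_fun le_max lexx /= ge_max ler01 /=.
have /andP[_ h] := normB_01 (vc ord0) (vc ord_max).
by rewrite lerBlDr; apply: le_trans h _; rewrite lerDl.
Qed.

Definition scaled_max_fun (c : R) (v : 'rV[R]_2) : R :=
  Num.max (v ord0 ord0) (c * v ord0 ord_max).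

Lemma scaled_max_continuous c :
  {within @unit_cube R 2, continuous (scaled_max_fun c)}.
Proof.
apply: continuous_subspaceT => v.
have FF : Filter (nbhs v) := nbhs_filter v.
have c2 := cvgM (@cvg_cst _ c _ (nbhs v) FF) (@coord_within ord_max v).
exact: (continuous_max (@coord_within ord0 v) (c2 FF)).
Qed.

Lemma scaled_max_01 c (c01 : 0 <= c <= 1) (v : 'rV[R]_2) :
  unit_cube v -> 0 <= scaled_max_fun c v <= 1.
Proof.
move=> vc; rewrite /scaled_max_fun le_max ge_max.
have /andP[-> ->] := vc ord0; have /andP[h0 h1] := vc ord_max.
by case/andP: c01 => c0 c1; rewrite mulr_ile1.
Qed.

Variable L : language.

Definition excess_formula e (e0 : 0 <= e) (phi psi : formula R L) : formula R L :=
  Conn 2 (Connective (@excess_continuous e) (excess_01 e0)) (pair_tuple phi psi).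

Definition scaled_max_formula c (c01 : 0 <= c <= 1) (phi psi : formula R L) :
    formula R L :=
  Conn 2 (Connective (@scaled_max_continuous c) (scaled_max_01 c01))
    (pair_tuple phi psi).

Lemma value_excess (M : structure R L) (s : nat -> M) e (e0 : 0 <= e) phi psi :
  value s (excess_formula e0 phi psi) = Num.max 0 (`|value s phi - value s psi| - e).
Proof. by rewrite /= /excess_fun !mxE. Qed.

Lemma value_scaled_max (M : structure R L) (s : nat -> M) c (c01 : 0 <= c <= 1) phi psi :
  value s (scaled_max_formula c01 phi psi) = Num.max (value s phi) (c * value s psi).
Proof. by rewrite /= /scaled_max_fun !mxE. Qed.

Lemma value_excess_eq0 (M : structure R L) (s : nat -> M) e (e0 : 0 <= e) phi psi :
  value s (excess_formula e0 phi psi) = 0 <-> `|value s phi - value s psi| <= e.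
Proof.
rewrite value_excess -subr_le0; split=> [h|h]; last exact/max_idPl.
by rewrite -[X in _ <= X]h le_max lexx orbT.
Qed.

Lemma free_pair_tuple x n (phi psi : formula R L) (i : 'I_n) :
  Defs.free x (pair_tuple phi psi i) -> Defs.free x phi \/ Defs.free x psi.
Proof. by rewrite /pair_tuple; case: ifP; [left|right]. Qed.

End BinaryConnective.

Lemma empty_range m x : (m <= x < m)%N = false.
Proof. by apply/negP => /andP[/leq_ltn_trans h /h]; rewrite ltnn. Qed.

Section SupBlock.
Variables (R : realType) (L : language).

(** Stands in for the supremum over all assignments in [rho], which is no quantifier: an atomic
    formula depends only on the variables below its [abound]. *)
Fixpoint sup_block m r (phi : formula R L) : formula R L :=
  if r is r'.+1 then Sup m (sup_block m.+1 r' phi) else phi.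

Definition agree_off (T : Type) m r (s s' : nat -> T) :=
  forall x, ~~ (m <= x < m + r)%N -> s' x = s x.

Lemma free_sup_block x m r phi :
  Defs.free x (sup_block m r phi) -> Defs.free x phi /\ ~~ (m <= x < m + r)%N.
Proof.
elim: r m => [|r IH] m /=.
  by move=> xphi; split=> //; rewrite addn0 empty_range.
case=> /eqP xm /IH[xphi h]; split=> //; apply: contra h => /andP[mx xr].
by rewrite ltn_neqAle eq_sym xm mx addSnnS.
Qed.

Variable M : structure R L.

Lemma value_sup_block_ub m r phi (s s' : nat -> M) : agree_off m r s s' ->
  value s' phi <= value s (sup_block m r phi).
Proof.
elim: r m s => [|r IH] m s ss' /=.
  rewrite (_ : s' = s)//; apply/funext => x; apply: ss'.
  by rewrite addn0 empty_range.
apply: le_trans (sup_image_ub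
  (g := fun a => value (update s m a) (sup_block m.+1 r phi)) _ (s' m)); last first.
  by move=> a; exact: value_01.
apply: IH => x xm; rewrite /update; case: eqP => [->//|/eqP xNm]; apply: ss'.
by apply: contra xm => /andP[mx xr]; rewrite ltn_neqAle eq_sym xNm mx addSnnS.
Qed.

Lemma value_sup_block_le m r phi (s : nat -> M) c :
  (forall s', agree_off m r s s' -> value s' phi <= c) ->
  value s (sup_block m r phi) <= c.
Proof.
elim: r m s => [|r IH] m s h /=; first by apply: h.
apply: sup_image_le => [|a]; first exact: universe_inhabited.
apply: IH => s' ss'; apply: h => x xm; rewrite ss' /update.
  by case: eqP => // xem; move: xm; rewrite xem leqnn /= addnS ltnS leq_addr.
by apply: contra xm => /andP[mx xr]; rewrite (ltnW mx) -addSnnS.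
Qed.

End SupBlock.

Section DistanceFormula.
Variables (R : realType) (L : language) (al : nat -> option (atom L * nat)).
Local Notation w k := ((2^-1 : R) ^+ k).

(* Variable y receives t, and the others are moved past the variables that are
   below m, where they can be quantified without capture. *)
Definition shift_subst m y (t : term L) z : term L := if z == y then t else Var (m + z).

Definition atom_formula (q : atom L) : formula R L := Atom (tag q) (tagged q).

Definition rho_formula (qx : atom L * nat) (t1 t2 : term L) : formula R L :=
  let m := maxn (tbound t1) (tbound t2) in
  sup_block m (abound qx.1)
    (excess_formula (lexx 0)
      (atom_formula (asubst (shift_subst m qx.2 t1) qx.1))
      (atom_formula (asubst (shift_subst m qx.2 t2) qx.1))).

Lemma free_atom_asubst x (sigma : nat -> term L) q :
  Defs.free x (atom_formula (asubst sigma q)) ->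
  exists2 y, (y < abound q)%N & occurs x (sigma y).
Proof.
move=> [i /= /occurs_tsubst[y yi xy]]; exists y => //.
by apply: leq_trans (occurs_tbound yi) _; apply: (leq_bigmax i).
Qed.

Lemma free_rho_formula x qx t1 t2 :
  Defs.free x (rho_formula qx t1 t2) -> occurs x t1 \/ occurs x t2.
Proof.
rewrite /rho_formula; set m := maxn _ _.
move=> /free_sup_block[[i /free_pair_tuple xf] xm].
have H t : Defs.free x (atom_formula (asubst (shift_subst m qx.2 t) qx.1)) -> occurs x t.
  move=> /free_atom_asubst[y yq]; rewrite /shift_subst; case: eqP => //= _ xy.
  by move: xm; rewrite xy leq_addr ltn_add2l yq.
by case: xf => /H; [left|right].
Qed.

Lemma value_rho_formula (M : structure R L) (s : nat -> M) qx t1 t2 :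
  value s (rho_formula qx t1 t2) = rho qx.1 qx.2 (teval s t1) (teval s t2).
Proof.
rewrite /rho_formula; set m := maxn _ _; case: qx => q y /=.
have bodyE (s' : nat -> M) : agree_off m (abound q) s s' ->
  value s' (excess_formula (lexx 0) (atom_formula (asubst (shift_subst m y t1) q))
      (atom_formula (asubst (shift_subst m y t2) q))) =
  `|aval (update (fun z => s' (m + z)%N) y (teval s t1)) q
    - aval (update (fun z => s' (m + z)%N) y (teval s t2)) q|.
  move=> ss'; rewrite value_excess subr0 (max_r (normr_ge0 _)).
  have tE t : (tbound t <= m)%N ->
      value s' (atom_formula (asubst (shift_subst m y t) q)) =
      aval (update (fun z => s' (m + z)%N) y (teval s t)) q.
    move=> tm; rewrite -[LHS]/(aval s' (asubst (shift_subst m y t) q)) aval_asubst.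
    congr aval; apply/funext => z; rewrite /shift_subst /update.
    case: eqP => //= _; apply: teval_eq => x /occurs_tbound xt; apply: ss'.
    by rewrite leqNgt (leq_trans xt tm).
  by rewrite !tE ?leq_max ?leqnn ?orbT.
apply/eqP; rewrite eq_le; apply/andP; split.
  by apply: value_sup_block_le => s' ss'; rewrite bodyE//; exact: rho_ub.
apply: rho_le => u.
(* Only the values of [u] below [abound q] are copied into the quantified block; [q] does not see
   the others. *)
pose s' x := if (m <= x < m + abound q)%N then u (x - m)%N else s x.
have ss' : agree_off m (abound q) s s' by move=> x /negbTE xm; rewrite /s' xm.
apply: le_trans (value_sup_block_ub _ ss'); rewrite bodyE//.
have H a : aval (update u y a) q = aval (update (fun z => s' (m + z)%N) y a) q.
  apply: aval_eq => x xq; rewrite /update; case: eqP => // _.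
  by rewrite /s' leq_addr ltn_add2l xq addKn.
by rewrite !H.
Qed.

Lemma expr_half_01 k : 0 <= w k <= 1.
Proof.
by rewrite ltW ?expr_half_gt0//= -[leRHS](expr0 (2^-1)) expr_half_le.
Qed.

Fixpoint dist_formula n (t1 t2 : term L) : formula R L :=
  if n is n'.+1 then
    scaled_max_formula (expr_half_01 n') (dist_formula n' t1 t2)
      (if al n' is Some qx then rho_formula qx t1 t2 else zero_formula R L)
  else zero_formula R L.

Lemma free_dist_formula x n t1 t2 :
  Defs.free x (dist_formula n t1 t2) -> occurs x t1 \/ occurs x t2.
Proof.
have zf : ~ Defs.free x (zero_formula R L) by case=> -[].
elim: n => [/zf//|n IH] [i /free_pair_tuple[/IH//|]].
by case: al => [qx /free_rho_formula|/zf].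
Qed.

Lemma value_dist_formula (M : structure R L) (s : nat -> M) n t1 t2 :
  value s (dist_formula n t1 t2) = dist_upto al n (teval s t1) (teval s t2).
Proof.
elim: n => [//|n IH]; rewrite [dist_formula _ _ _]/= value_scaled_max IH /= /orho.
case: al => [qx|] //.
by rewrite value_rho_formula.
Qed.

End DistanceFormula.

(** * The language with a distance symbol and its canonical interpretation *)

Definition add_distance (L : language) : language :=
  {| csymb := csymb L;
     fsymb := fsymb L;
     psymb := option (psymb L);
     farity := @farity L;
     parity := fun p => if p is Some p' then parity p' else 2 |}.

Definition distance_lmap (L : language) : lmap L (add_distance L) :=
  @LMap L (add_distance L) id id some (fun=> erefl) (fun=> erefl).

Section Expansion.
Variables (R : realType) (L : language).
Local Notation w k := ((2^-1 : R) ^+ k).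

Definition distance (M : structure R (add_distance L)) (a b : M) : R :=
  pinterp (p := None : psymb (add_distance L)) (pair_tuple a b).

Definition forget (M : structure R (add_distance L)) : structure R L :=
  reduct (distance_lmap L) M.

Definition expansion_pinterp (M : structure R L) (d : M -> M -> R)
    (p : psymb (add_distance L)) : ('I_(parity p) -> M) -> R :=
  match p with
  | Some p' => @pinterp R L M p'
  | None => fun x => d (x ord0) (x ord_max)
  end.

Lemma expansion_pinterp_01 (M : structure R L) (d : M -> M -> R)
  (d01 : forall a b, 0 <= d a b <= 1) p x :
  0 <= @expansion_pinterp M d p x <= 1.
Proof. by case: p x => [p|] x /=; [exact: pinterp_01|exact: d01]. Qed.

Definition expansion (M : structure R L) (d : M -> M -> R)
    (d01 : forall a b, 0 <= d a b <= 1) : structure R (add_distance L) :=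
  @Structure R (add_distance L) M (universe_inhabited M) (@cinterp R L M)
    (@finterp R L M) (@expansion_pinterp M d) (expansion_pinterp_01 d01).

Variable al : nat -> option (atom L * nat).

(** Bounds by truncations in place of an equality with [dist_all]: each bound is expressed by one
    sentence, so the property passes to models and to ultrapowers. *)
Definition canonical_distance (M : structure R (add_distance L)) : Prop :=
  forall n (a b : M), `|distance a b - dist_upto al n (M := forget M) a b| <= w n.

Fixpoint forget_term (t : term (add_distance L)) : term L :=
  match t with
  | Var x => Var x
  | Cst c => Cst (c : csymb L)
  | App f ts => App (f : fsymb L) (fun i => forget_term (ts i))
  end.

Lemma teval_forget (M : structure R (add_distance L)) (s : nat -> M) t :
  teval (M := forget M) s (forget_term t) = teval s t.
Proof.
elim: t => //= f ts IH; congr (@finterp R (add_distance L) M f _); apply/funext => i.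
by rewrite cast_ord_id.
Qed.

Lemma occurs_forget x t : occurs x (forget_term t) -> occurs x t.
Proof. by elim: t => //= f ts IH [i /IH]; exists i. Qed.

(** [psi] is chosen before [M], so one approximation serves all structures with a canonical
    distance. Atoms in [d] become truncations, connectives preserve closeness by uniform continuity,
    and suprema and infima do not increase the error. The clause on free variables keeps sentences
    sentences. *)
Lemma formula_approximation (phi : formula R (add_distance L)) e : 0 < e ->
  exists psi : formula R L, (forall x, Defs.free x psi -> Defs.free x phi) /\
    forall M, canonical_distance M -> forall s : nat -> M,
      `|value s phi - value (M := forget M) s psi| <= e.
Proof.
elim: phi e => [[p|] ts|n c phi IH|x phi IH|x phi IH] e e0.
- exists (Atom p (fun i => forget_term (ts i))); split.
    by move=> x [i /occurs_forget]; exists i.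
  move=> M _ s; rewrite (_ : value (M := forget M) s _ =
    value s (Atom (Some p : psymb (add_distance L)) ts)) ?subrr ?normr0 ?ltW//=.
  congr (@pinterp R (add_distance L) M (Some p) _); apply/funext => i.
  by rewrite teval_forget cast_ord_id.
- have [n ne] := expr_half_small e0.
  exists (dist_formula R al n (forget_term (ts ord0)) (forget_term (ts ord_max))); split.
    by move=> x /free_dist_formula[] /occurs_forget; [exists ord0|exists ord_max].
  move=> M cM s; rewrite value_dist_formula !teval_forget; apply: le_trans ne.
  have /= := cM n (teval s (ts ord0)) (teval s (ts ord_max)).
  rewrite /distance; set x := pair_tuple _ _; set y := fun i => _.
  suff -> : x = y by [].
  apply/funext => i; rewrite /x /y /pair_tuple.
  by case: i => [[|[|//]] h] /=; congr (teval s (ts _)); exact: val_inj.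
- have [d d0 dP] := connective_unif_continuous c e0.
  have d20 : 0 < d / 2 by rewrite divr_gt0.
  have /choice[psi psiP] := fun i => IH i _ d20.
  exists (Conn n c psi); split; first by move=> x [i /(proj1 (psiP i))]; exists i.
  move=> M cM s /=; apply: dP => [i|i|i]; rewrite !mxE ?value_01//.
  apply: le_lt_trans (proj2 (psiP i) M cM s) _.
  by rewrite ltr_pdivrMr// ltr_pMr// ltr1n.
- have [psi [fpsi psiP]] := IH _ e0.
  exists (Sup x psi); split; first by move=> y [xy /fpsi].
  move=> M cM s /=; apply: sup_image_dist => [|a|a|a]; rewrite ?value_01 ?psiP//.
    exact: universe_inhabited.
- have [psi [fpsi psiP]] := IH _ e0.
  exists (Inf x psi); split; first by move=> y [xy /fpsi].
  move=> M cM s /=; apply: inf_image_dist => [|a|a|a]; rewrite ?value_01 ?psiP//.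
    exact: universe_inhabited.
Qed.

Definition distance_atom : formula R (add_distance L) :=
  Atom (None : psymb (add_distance L)) (pair_tuple (Var 0) (Var 1)).

Definition distance_axiom n : formula R (add_distance L) :=
  Sup 0 (Sup 1 (excess_formula (ltW (expr_half_gt0 R n)) distance_atom
    (phmap (distance_lmap L) (dist_formula R al n (Var 0) (Var 1))))).

Lemma sentence_distance_axiom n : sentence (distance_axiom n).
Proof.
move=> x [x0 [x1 [i /free_pair_tuple[]]]].
  by case=> j; rewrite /pair_tuple; case: ifP.
by move=> /free_phmap /free_dist_formula[].
Qed.

Lemma value_distance_axiom (M : structure R (add_distance L)) :
  canonical_distance M <->
  forall n (s : nat -> M), value s (distance_axiom n) = 0.
Proof.
pose body n := excess_formula (ltW (expr_half_gt0 R n)) distance_atom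
    (phmap (distance_lmap L) (dist_formula R al n (Var 0) (Var 1))).
have bodyE n (s : nat -> M) : value s (body n) = 0 <->
    `|distance (s 0) (s 1) - dist_upto al n (M := forget M) (s 0) (s 1)| <= w n.
  rewrite value_excess_eq0 value_phmap value_dist_formula.
  suff -> : value s distance_atom = distance (s 0%N) (s 1%N) by [].
  congr pinterp; apply/funext => i; rewrite /pair_tuple; by case: ifP.
have T0 := universe_inhabited M.
split=> [cM n s|h n a b].
  apply/eqP; rewrite eq_le; case/andP: (value_01 (distance_axiom n) s) => -> _.
  rewrite andbT; apply: sup_image_le => // a; apply: sup_image_le => // b.
  by rewrite le_eqVlt; apply/orP; left; apply/eqP/(bodyE n); exact: cM.
pose s x := if x == 0%N then a else b.
have := proj1 (bodyE n s); apply; apply/eqP; rewrite eq_le.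
case/andP: (value_01 (body n) s) => -> _; rewrite andbT -(h n s).
apply: le_trans (sup_image_ub (g := fun a =>
  sup [set value (update (update s 0 a) 1 b) (body n) | b in [set: M]]) _ a);
  last first.
  by move=> a'; apply: sup_image_01 => // b'; exact: value_01.
apply: le_trans (sup_image_ub (g := fun b =>
  value (update (update s 0 a) 1 b) (body n)) _ b); last first.
  by move=> b'; exact: value_01.
rewrite (_ : update _ _ _ = s)//; apply/funext => -[|[|x]] //.
Qed.

End Expansion.

(** * Complete metric ultrapowers *)

Section Premetric.
Variables (R : realType) (V : vocabulary) (sig : metric_signature R V).
Local Notation w k := ((2^-1 : R) ^+ k).

(** The clauses of a metric structure except separation and completeness, the two that may fail
    before the passage to an ultrapower and its quotient. *)
Definition premetric (P : structure R V) : Prop :=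
  [/\ forall x : P, sdist sig x x = 0,
      forall x y : P, sdist sig x y = sdist sig y x,
      forall x y z : P, sdist sig x z <= sdist sig x y + sdist sig y z,
      forall (f : fsymb V) (x y : 'I_(farity f) -> P) e, 0 < e <= 1 ->
        (forall i, sdist sig (x i) (y i) < fmodulus sig f e) ->
        sdist sig (finterp x) (finterp y) <= e &
      forall (p : psymb V) (x y : 'I_(parity p) -> P) e, 0 < e <= 1 ->
        (forall i, sdist sig (x i) (y i) < pmodulus sig p e) ->
        `|pinterp x - pinterp y| <= e].

Lemma sdist_01 (P : structure R V) (x y : P) : 0 <= sdist sig x y <= 1.
Proof. exact: pinterp_01. Qed.

Section Reduction.
Variable P : structure R V.

Lemma sdist_reduce (a b : P) : sdist sig (reduce a) (reduce b) = sdist sig a b.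
Proof.
rewrite /sdist -[RHS]reduce_pinterp; congr pinterp; apply/funext => i.
by rewrite /pair_tuple; case: ifP.
Qed.

Hypothesis Pd : premetric P.

(** Since every tolerance is allowed, distance 0 propagates through function symbols, hence through
    terms, and then to the values of predicates. *)
Lemma sdist0_indistinguishable (a b : P) : sdist sig a b = 0 -> indistinguishable a b.
Proof.
case: Pd => drefl _ _ df dp ab p ts x s.
have dt t : sdist sig (teval (update s x a) t) (teval (update s x b) t) = 0.
  elim: t => /= [y|c|f us IH]; rewrite ?drefl//.
    by rewrite /update; case: eqP.
  apply/eqP; rewrite eq_le; case/andP: (sdist_01 (finterp (fun i => teval (update s x a) (us i)))
    (finterp (fun i => teval (update s x b) (us i)))) => -> _; rewrite andbT.
  apply/ler_addgt0Pr => e e0; rewrite add0r.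
  (* The modulus is known to be positive only at tolerances in [(0, 1]]. *)
  apply: (@le_trans _ _ (Num.min e 1)); last by rewrite ge_min lexx.
  have e01 : 0 < Num.min e 1 <= 1 by rewrite lt_min e0 ltr01 ge_min lexx orbT.
  apply: df => // i; rewrite IH.
  by case/andP: (modulus_01 (fmodulus sig f) e01).
apply/eqP; rewrite -subr_eq0 -normr_le0.
apply/ler_addgt0Pr => e e0; rewrite add0r.
apply: (@le_trans _ _ (Num.min e 1)); last by rewrite ge_min lexx.
have e01 : 0 < Num.min e 1 <= 1 by rewrite lt_min e0 ltr01 ge_min lexx orbT.
apply: dp => // i; rewrite dt.
by case/andP: (modulus_01 (pmodulus sig p) e01).
Qed.

Lemma reduction_metric : cauchy_complete (@sdist R V sig P) ->
  L_metric_structure sig (reduction P).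
Proof.
move=> complete; case: (Pd) => drefl dsym dtri df dp; split.
- split=> x y; rewrite -(choose_repK x) -(choose_repK y) ?sdist_reduce.
  + split=> [|/reduce_indistinguishable xy]; first by
      move/sdist0_indistinguishable/reduce_indistinguishable.
    rewrite -(drefl (choose_rep x)) -!sdist_reduce; congr sdist.
    exact/esym/reduce_indistinguishable.
  + exact: dsym.
  + by move=> z; rewrite -(choose_repK z) !sdist_reduce; exact: dtri.
- move=> u cu; have [|l lP] := complete (fun n => choose_rep (u n)).
    move=> e /cu[N NP]; exists N => m n mN nN.
    by rewrite -sdist_reduce !choose_repK; exact: NP.
  exists (reduce l) => e /lP[N NP]; exists N => n nN.
  by rewrite -(choose_repK (u n)) sdist_reduce; exact: NP.
- move=> f x y e e01 xy.
  have xE (z : 'I_(farity f) -> reduction P) :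
      finterp z = reduce (finterp (fun i => choose_rep (z i))).
    by [].
  rewrite !xE sdist_reduce; apply: df => // i.
  by rewrite -sdist_reduce !choose_repK.
- move=> p x y e e01 xy; apply: dp => // i.
  by have := xy i; rewrite -{1}(choose_repK (x i)) -{1}(choose_repK (y i)) sdist_reduce.
Qed.

End Reduction.

Section Ultrapower.
Variables (P : structure R V) (I : Type) (D : ultrafilter I).
Hypothesis Pd : premetric P.
Local Notation Ds := (ultrafilter_sets D).

Lemma sdist_pre_ultrapower (x y : pre_ultrapower P D) :
  sdist sig x y = lim (sdist sig (x t) (y t) @[t --> Ds]).
Proof.
apply: eq_ultra_lim => t; congr pinterp; apply/funext => i.
by rewrite /pair_tuple; case: ifP.
Qed.

(** Moduli survive because their hypothesis is strict and their conclusion is not: an ultralimit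
    below the modulus is below it on a set of the ultrafilter, and a weak bound there passes to the
    limit. Finite arity allows intersecting over the arguments. *)
Lemma premetric_pre_ultrapower : premetric (pre_ultrapower P D).
Proof.
case: Pd => drefl dsym dtri df dp.
have near_all n (m : R) (x y : 'I_n -> pre_ultrapower P D) :
    (forall i, sdist sig (x i) (y i) < m) ->
    \forall t \near Ds, forall i, sdist sig (x i t) (y i t) < m.
  move=> xy; apply: filter_forall => i; apply: ultra_lim_lt => [t|].
    exact: sdist_01.
  by rewrite -sdist_pre_ultrapower.
split.
- move=> x; rewrite sdist_pre_ultrapower (_ : (fun t => _) = fun=> 0).
    by apply: cvg_lim => //; exact: cvg_cst.
  exact/funext.
- move=> x y; rewrite !sdist_pre_ultrapower; apply: eq_ultra_lim => t; exact: dsym.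
- move=> x y z; rewrite !sdist_pre_ultrapower -[leRHS]addr0 -addrA.
  apply/ler_addgt0Pr => e e0; rewrite addr0.
  set ly := lim (sdist sig (y _) (z _) @[_ --> _]).
  have /(ultra_lim_lt (fun t => sdist_01 (y t) (z t))) yz : ly < ly + e by rewrite ltrDl.
  rewrite -addrA; apply: ultra_ler_lim => [t|t|]; [exact: sdist_01..|].
  by apply: filterS yz => t yz; apply: le_trans (dtri _ (y t) _) _; rewrite lerD2l ltW.
- move=> f x y e e01 /near_all xy; rewrite sdist_pre_ultrapower.
  apply: ultra_lim_le => [t|]; first exact: sdist_01.
  by apply: filterS xy => t xyt; exact: df.
- move=> p x y e e01 /near_all xy.
  have {}xy : \forall t \near Ds,
      `|pinterp (fun i => x i t) - pinterp (fun i => y i t)| <= e.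
    by apply: filterS xy => t xyt; exact: dp.
  have p01 (z : 'I_(parity p) -> pre_ultrapower P D) t : 0 <= pinterp (fun i => z i t) <= 1.
    exact: pinterp_01.
  rewrite ler_norml lerBrDr addrC lerBlDr lerBlDl.
  apply/andP; split; apply: ultra_ler_lim => //; apply: filterS xy => t;
    by rewrite ler_norml => /andP[]; lra.
Qed.

End Ultrapower.

Section Completeness.
Variables (P : structure R V) (D : ultrafilter nat).
Hypothesis Pd : premetric P.
Hypothesis D_free : forall n, ultrafilter_sets D [set t | (n <= t)%N].
Local Notation Ds := (ultrafilter_sets D).

(* A diagonal argument: the limit follows the k-th term of a fast subsequence
   at the coordinates where its first k terms are as close as they are in the
   ultrapower. *)
Lemma pre_ultrapower_complete :
  cauchy_complete (@sdist R V sig (pre_ultrapower P D)).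
Proof.
have [drefl dsym dtri _ _] := premetric_pre_ultrapower D Pd.
move=> u cu.
have /choice[N NP] k := cu _ (expr_half_gt0 R k).
(* [K k] dominates [N 0, ..., N k], so for [i <= j] the terms [v i] and [v j] of the subsequence are
   within [w i]. *)
pose K k := \max_(j < k.+1) N j.
have NK i j : (i <= j)%N -> (N i <= K j)%N.
  move=> ij; rewrite -[i]/(val (Ordinal (ij : (i < j.+1)%N))).
  exact: (leq_bigmax (F := fun i : 'I_j.+1 => N i)).
pose v k : nat -> P := u (K k).
pose ok n t := forall i j : 'I_n.+1, (i <= j)%N -> sdist sig (v i t) (v j t) < w i.
have okD n : \forall t \near Ds, ok n t.
  apply: filter_forall => i; apply: filter_forall => j.
  have [ij|ji] := leqP i j; last by apply: filterE.
  have : sdist sig (v i : pre_ultrapower P D) (v j) < w i by apply: NP; exact: NK.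
  rewrite sdist_pre_ultrapower => /(ultra_lim_lt (fun t => sdist_01 (v i t) (v j t))).
  exact: filterS.
have ok0 t : ok 0 t.
  move=> i j _; rewrite !ord1 expr0; case: Pd => -> *; exact: ltr01.
have best t m : exists k, ok k t /\ forall n, (n <= m)%N -> ok n t -> (n <= k)%N.
  elim: m => [|m [k [okk kP]]].
    by exists 0%N; split=> // n; rewrite leqn0 => /eqP->.
  have [okm|nokm] := pselect (ok m.+1 t); first by exists m.+1.
  exists k; split=> // n; rewrite leq_eqVlt => /orP[/eqP-> /nokm//|nm].
  exact: kP.
(* Searching only up to [t] makes a largest good index exist; for fixed [n] the bound is harmless,
   since [n <= t] on a set of the ultrafilter. *)
have /choice[k kP] t := best t t.
pose x : pre_ultrapower P D := fun t => v (k t) t.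
have vx n : sdist sig (v n : pre_ultrapower P D) x <= w n.
  rewrite sdist_pre_ultrapower; apply: ultra_lim_le => [t|]; first exact: sdist_01.
  apply: filterS2 (D_free n) (okD n) => t nt okn.
  have [okk /(_ n nt okn) nk] := kP t.
  rewrite -ltnS in nk.
  by apply/ltW/(okk (Ordinal nk) ord_max); rewrite -ltnS.
exists x => e e0; have e20 : 0 < e / 2 by rewrite divr_gt0.
have [n ne] := expr_half_small e20.
exists (N n) => m mN; apply: le_lt_trans (dtri _ (v n) _) _.
have h : sdist sig (u m) (v n : pre_ultrapower P D) < w n by apply: NP => //; exact: NK.
have := vx n; lra.
Qed.

End Completeness.
End Premetric.

Lemma nonprincipal_ultrafilter :
  exists D : ultrafilter nat, forall n, ultrafilter_sets D [set t | (n <= t)%N].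
Proof.
have [G [UG oG]] := ultraFilterLemma eventually_filter.
by exists (Ultrafilter UG) => n; apply: oG; exists n.
Qed.

(** * Countability of the expanded vocabulary *)

Section Countability.
Variables (L : language) (cc : csymb L -> nat) (cf : fsymb L -> nat) (cp : psymb L -> nat).
Hypotheses (cc_inj : injective cc) (cf_inj : injective cf) (cp_inj : injective cp).

(** Terms embed into finitely branching trees labelled by numbers, a countable type. The code of [f]
    determines the arity, so it is enough to list the subtrees. *)
Fixpoint term_code (t : term L) : GenTree.tree nat :=
  match t with
  | Var x => GenTree.Node 0 [:: GenTree.Leaf x]
  | Cst c => GenTree.Node 1 [:: GenTree.Leaf (cc c)]
  | App f ts => GenTree.Node 2
      (GenTree.Leaf (cf f) :: [seq term_code (ts i) | i <- enum 'I_(farity f)])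
  end.

Lemma term_code_inj : injective term_code.
Proof.
elim=> [x|c|f ts IH] [y|d|g us] //= [].
- by move=> ->.
- by move=> /cc_inj ->.
- move=> /cf_inj fg; case: g / fg us => us /eq_in_map tsus.
  by congr App; apply/funext => i; apply/IH/tsus; rewrite mem_enum.
Qed.

Definition atom_code (q : atom L) : GenTree.tree nat :=
  GenTree.Node (cp (tag q)) [seq term_code (tagged q i) | i <- enum 'I_(parity (tag q))].

Lemma atom_code_inj : injective atom_code.
Proof.
move=> [p ts] [r us] [] /= /cp_inj pr; case: r / pr us => us /eq_in_map tsus.
congr (existT _ p _); apply/funext => i; apply/term_code_inj/tsus.
by rewrite mem_enum.
Qed.

End Countability.

Lemma countable_inj (T : Type) :
  countable [set: T] -> exists f : T -> nat, injective f.
Proof.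
by move=> /countable_injP[f f_inj]; exists f => x y; apply: f_inj; rewrite in_setT.
Qed.

(** The list is the partial inverse of an injective coding, with [None] at numbers that code no
    pair. *)
Lemma atom_enumeration (V : vocabulary) :
  exists al : nat -> option (atom V * nat), forall q x, exists k, al k = Some (q, x).
Proof.
have [cc cc_inj] := countable_inj (countable_csymb V).
have [cf cf_inj] := countable_inj (countable_fsymb V).
have [cp cp_inj] := countable_inj (countable_psymb V).
pose code (qx : atom V * nat) := pickle (atom_code cc cf cp qx.1, qx.2).
have code_inj : injective code.
  move=> [q x] [r y] /(pcan_inj pickleK) qr; congr (_, _); last first.
    exact: (congr1 snd qr).
  exact: (atom_code_inj cc_inj cf_inj cp_inj (congr1 fst qr)).
have /choice[al alP] (k : nat) : exists o, forall qx, code qx = k -> o = Some qx.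
  have [[qx <-]|no] := pselect (exists qx, code qx = k).
    by exists (Some qx) => ry /code_inj ->.
  by exists None => qx qxk; case: no; exists qx.
by exists al => q x; exists (code (q, x)); exact: alP.
Qed.

Lemma countable_option (T : Type) : countable [set: T] -> countable [set: option T].
Proof.
move=> /countable_inj[f f_inj]; apply/countable_injP.
exists (fun o => if o is Some x then (f x).+1 else 0%N) => -[x|] [y|] _ _ //.
by move=> [] /f_inj ->.
Qed.

Definition distance_vocabulary (V : vocabulary) : vocabulary :=
  @Vocabulary (add_distance V) (countable_csymb V) (countable_fsymb V)
    (countable_option (countable_psymb V)).

(** * Invariance of the distance under change of language *)

Section DistanceTransfer.
Variable R : realType.

Lemma dist_upto_amap (L L' : language) (F : lmap L L') (N : structure R L')
    (al : nat -> option (atom L * nat)) n (a b : N) :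
  dist_upto (fun k => omap (fun qx => (amap F qx.1, qx.2)) (al k)) n a b =
  dist_upto al n (M := reduct F N) a b.
Proof.
elim: n => //= n ->; congr (Num.max _ (_ * _)); rewrite /orho.
case: al => //= -[q x] /=; congr sup; apply: eq_imagel => s _.
by rewrite !aval_amap.
Qed.

Lemma dist_upto_hom (L : language) (M N : structure R L) (h : M -> N)
    (al : nat -> option (atom L * nat)) n (a b : M) :
  (forall b, exists a, h a = b) ->
  (forall (s : nat -> M) q, aval (fun x => h (s x)) q = aval s q) ->
  dist_upto al n (h a) (h b) = dist_upto al n a b.
Proof.
move=> h_surj hE; elim: n => //= n ->; congr (Num.max _ (_ * _)); rewrite /orho.
case: al => //= -[q x] /=; congr sup; apply/seteqP; split => _ [s _ <-].
  have /choice[s' s'E] := fun x => h_surj (s x).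
  by exists s' => //; rewrite -!hE -!update_hom (_ : (fun x => _) = s)//; apply/funext.
by exists (fun x => h (s x)) => //; rewrite !update_hom !hE.
Qed.

Lemma value_forget_expansion (L : language) (M : structure R L) d
    (d01 : forall a b, 0 <= d a b <= 1) (s : nat -> M) (phi : formula R L) :
  value (M := forget (expansion d01)) s phi = value s phi.
Proof.
apply: (@value_hom _ _ M (forget (expansion d01)) id) => //.
- by move=> b; exists b.
- by move=> f x /=; congr (@finterp R L M f _); apply/funext => i; rewrite cast_ord_id.
- by move=> p x /=; congr (@pinterp R L M p _); apply/funext => i; rewrite cast_ord_id.
Qed.

Lemma canonical_expansion (L : language) (al : nat -> option (atom L * nat))
    (M : structure R L) : canonical_distance al (expansion (@dist_all_01 R L al M)).
Proof.
move=> n a b.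
rewrite (@dist_upto_hom L M (forget (expansion (@dist_all_01 R L al M))) id).
- exact: dist_all_upto.
- by move=> c; exists c.
- by move=> s q; exact: (value_forget_expansion _ s (atom_formula R q)).
Qed.

Definition constants_lmap (L : language) (C : Type) : lmap L (add_constants L C) :=
  @LMap L (add_constants L C) inl id id (fun=> erefl) (fun=> erefl).

(** After parameters are added, the distance is still the one given by the atomic formulas without
    the new constants, carried along [constants_lmap]; this makes [formula_approximation] available
    for conditions with parameters. The ascription typechecks because adding constants and adding
    [d] commute up to conversion. *)
Lemma canonical_expand_by (L : language) (al : nat -> option (atom L * nat))
    (M : structure R (add_distance L)) (C : Type) (c : C -> M) :
  canonical_distance al M ->
  canonical_distance
    (fun k => omap (fun qx => (amap (constants_lmap L C) qx.1, qx.2)) (al k))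
    (expand_by c : structure R (add_distance (add_constants L C))).
Proof.
move=> cM n a b; rewrite dist_upto_amap.
rewrite (_ : dist_upto _ _ _ _ = dist_upto al n (M := forget M) a b).
  exact: cM.
apply: (@dist_upto_hom L (forget M) (reduct (constants_lmap L C)
  (forget (expand_by c : structure R (add_distance (add_constants L C))))) id).
  by move=> x; exists x.
move=> s q; apply: (@value_hom _ _ (forget M) (reduct (constants_lmap L C)
  (forget (expand_by c : structure R (add_distance (add_constants L C))))) id _ _ _ _ s
  (atom_formula R q)) => //.
- by move=> x; exists x.
- move=> f x /=; congr (@finterp R (add_distance L) M f _).
  by apply/funext => i; rewrite !cast_ord_id.
- move=> p x /=; congr (@pinterp R (add_distance L) M (Some p) _).
  by apply/funext => i; rewrite !cast_ord_id.
Qed.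

End DistanceTransfer.

Lemma modulus_exists (R : realType) (Q : R -> R -> Prop) :
  (forall e delta delta', delta' <= delta -> Q e delta -> Q e delta') ->
  (forall e, 0 < e -> exists2 delta, 0 < delta & Q e delta) ->
  exists m : modulus R, forall e, 0 < e <= 1 -> Q e (m e).
Proof.
move=> Q_le Q_ex.
have /choice[m mP] (e : R) : exists delta, 0 < e -> 0 < delta <= 1 /\ Q e delta.
  have [e0|] := pselect (0 < e); last by exists 0.
  have [d d0 dP] := Q_ex e e0; exists (Num.min d 1) => _; split.
    by rewrite lt_min d0 ltr01 ge_min lexx orbT.
  by apply: Q_le dP; rewrite ge_min lexx.
have m01 e : 0 < e <= 1 -> 0 < m e <= 1 by case/andP => /mP[].
by exists (Modulus m01) => e /andP[/mP[]].
Qed.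

(** * The metric theory *)

Section MetricExpansion.
Variables (R : realType) (V : vocabulary) (al : nat -> option (atom V * nat)).

Definition metric_expansion (M : structure R V) : structure R (distance_vocabulary V) :=
  expansion (@dist_all_01 R V al M).

Lemma metric_expansion_premetric (M : structure R V) :
  (forall q x, exists k, al k = Some (q, x)) ->
  exists sig : metric_signature R (distance_vocabulary V),
    premetric sig (metric_expansion M).
Proof.
move=> al_surj; pose d := dist_all al (M := M).
have /choice[fm fmP] (f : fsymb V) : exists m : modulus R, forall e, 0 < e <= 1 ->
    forall x y : 'I_(farity f) -> M, (forall i, d (x i) (y i) < m e) ->
    d (finterp x) (finterp y) <= e.
  apply: (modulus_exists (Q := fun e delta => forall x y : 'I_(farity f) -> M,
    (forall i, d (x i) (y i) < delta) -> d (finterp x) (finterp y) <= e)).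
    by move=> e r r' rr' Q x y xy; apply: Q => i; exact: lt_le_trans (xy i) rr'.
  by move=> e e0; exact: finterp_unif_continuous.
have /choice[pm pmP] (p : psymb (distance_vocabulary V)) : exists m : modulus R,
    forall e, 0 < e <= 1 -> forall x y : 'I_(parity p) -> metric_expansion M,
    (forall i, d (x i) (y i) < m e) -> `|pinterp x - pinterp y| <= e.
  apply: (modulus_exists (Q := fun e delta => forall x y : 'I_(parity p) -> metric_expansion M,
    (forall i, d (x i) (y i) < delta) -> `|pinterp x - pinterp y| <= e)).
    by move=> e r r' rr' Q x y xy; apply: Q => i; exact: lt_le_trans (xy i) rr'.
  move=> e e0; case: p => [p|]; first exact: (@pinterp_unif_continuous R V al M al_surj p e e0).
  (* The new symbol is handled by the triangle inequality: moving both arguments by less than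
     [e / 2] changes [d] by less than [e]. *)
  exists (e / 2) => [|x y xy]; first by rewrite divr_gt0.
  have h0 := xy ord0; have h1 := xy ord_max.
  change (`|d (x ord0) (x ord_max) - d (y ord0) (y ord_max)| <= e).
  have := dist_all_triangle al (M := M) (x ord0) (y ord0) (x ord_max).
  have := dist_all_triangle al (M := M) (y ord0) (y ord_max) (x ord_max).
  have := dist_all_triangle al (M := M) (y ord0) (x ord0) (y ord_max).
  have := dist_all_triangle al (M := M) (x ord0) (x ord_max) (y ord_max).
  rewrite (dist_all_sym al (y ord_max)) (dist_all_sym al (y ord0) (x ord0)) -/d.
  by rewrite ler_norml; lra.
exists (@MetricSignature R (distance_vocabulary V) None erefl fm pm).
split.
- exact: (@dist_all_refl R V al M).
- exact: (@dist_all_sym R V al M).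
- exact: (@dist_all_triangle R V al M).
- by move=> f x y e e01 xy; exact: (fmP f e e01 x y xy).
- by move=> p x y e e01 xy; exact: (pmP p e e01 x y xy).
Qed.

Lemma Th_forget (N : structure R (distance_vocabulary V)) (phi : formula R V) :
  Th N (phmap (distance_lmap V) phi) -> sentence phi -> Th (forget N) phi.
Proof. by move=> [_ N0] sphi; split=> // s; rewrite -value_phmap. Qed.

(** An approximation turns truth of [phi] in one expansion into a sentence [psi <= e / 2] without
    [d], which the inclusion of theories hands to [M']; there it gives [phi <= e] for every [e].
    Thus every model of [T] expands to a model of [U]. *)
Lemma Th_metric_expansion (M M' : structure R V) :
  Th M `<=` Th M' -> Th (metric_expansion M) `<=` Th (metric_expansion M').
Proof.
move=> MM' phi [sphi v0]; split=> // s.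
apply/eqP; rewrite eq_le; case/andP: (value_01 phi s) => -> _; rewrite andbT.
apply/ler_addgt0Pr => e e0; rewrite add0r (splitr e).
have e20 : 0 < e / 2 by rewrite divr_gt0.
have [psi [fpsi psiP]] := formula_approximation al phi e20.
pose chi := excess_formula (ltW e20) psi (zero_formula R V).
have : Th M chi.
  split.
    by move=> x [i /free_pair_tuple[/fpsi /sphi//|[[]]]].
  move=> s'; apply/value_excess_eq0; rewrite subr0.
  have := psiP (metric_expansion M) (@canonical_expansion _ _ al M) s'.
  by rewrite v0 sub0r normrN value_forget_expansion.
move=> /MM'[_ /(_ s) /value_excess_eq0]; rewrite subr0 => psi_e.
have := psiP (metric_expansion M') (@canonical_expansion _ _ al M') s.
rewrite value_forget_expansion => h.
rewrite -(subrK (value (M := M') s psi) (value s phi)).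
by apply: lerD; [apply: le_trans h|apply: le_trans psi_e]; rewrite ler_norm.
Qed.

End MetricExpansion.

(** * Saturation with and without the distance symbol *)

Section SaturationTransfer.
Variables (R : realType) (I : Type) (D : ultrafilter I).

Lemma value_pre_ultrapower_expansion (L : language) (M : structure R L) (d : M -> M -> R)
    (d01 : forall a b, 0 <= d a b <= 1) (c : I -> I -> M)
    (s : nat -> I -> M) (phi : formula R (add_constants L I)) :
  value (M := forget (expand_by (M := pre_ultrapower (expansion d01) D) c
    : structure R (add_distance (add_constants L I)))) s phi =
  value (M := expand_by (M := pre_ultrapower M D) c) s phi.
Proof.
apply: (@value_hom _ _ (expand_by (M := pre_ultrapower M D) c)
  (forget (expand_by (M := pre_ultrapower (expansion d01) D) c
    : structure R (add_distance (add_constants L I)))) id) => //.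
- by move=> b; exists b.
- move=> f x /=; apply/funext => t; congr (@finterp R L M f _); apply/funext => i.
  by rewrite cast_ord_id.
- move=> p x /=; apply: eq_ultra_lim => t; congr (@pinterp R L M p _); apply/funext => i.
  by rewrite cast_ord_id.
Qed.

Lemma value_pre_ultrapower_forget (L : language) (N : structure R (add_distance L))
    (c : I -> I -> N) (s : nat -> I -> N) (phi : formula R (add_constants L I)) :
  value (M := forget (expand_by (M := pre_ultrapower N D) c
    : structure R (add_distance (add_constants L I)))) s phi =
  value (M := expand_by (M := pre_ultrapower (forget N) D) c) s phi.
Proof.
apply: (@value_hom _ _ (expand_by (M := pre_ultrapower (forget N) D) c)
  (forget (expand_by (M := pre_ultrapower N D) c
    : structure R (add_distance (add_constants L I)))) id) => //.
- by move=> b; exists b.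
Qed.

Lemma saturates_expansion (L : language) (M : structure R L) (d : M -> M -> R)
    (d01 : forall a b, 0 <= d a b <= 1) :
  saturates D (expansion (M := M) d01) -> saturates D M.
Proof.
rewrite !saturates_indexed => sat c G.
pose E : structure R (add_distance (add_constants L I)) :=
  expand_by (M := pre_ultrapower (expansion d01) D) c.
apply: (@satisfiable_transfer _ _ _ (expand_by (M := pre_ultrapower M D) c) E G
  (phmap (distance_lmap (add_constants L I)) @` G) id id).
- move=> _ [phi Gphi <-]; exists phi => // s.
  by rewrite (value_phmap (distance_lmap _) (N := E)) value_pre_ultrapower_expansion.
- move=> s sG phi Gphi; rewrite -(value_pre_ultrapower_expansion d01).
  by have := sG _ (imageP _ Gphi); rewrite (value_phmap (distance_lmap _) (N := E)).
- exact: (sat c (phmap (distance_lmap (add_constants L I)) @` G)).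
Qed.

(** A condition [phi = 0] is traded for the conditions [psi <= e], over every tolerance [e] and
    every approximation [psi] of [phi] within [e]. Each follows from [phi = 0] alone, so finite
    satisfiability is kept; together they make [phi] arbitrarily small, hence 0. *)
Lemma saturates_forget (L : language) (al' : nat -> option (atom L * nat))
    (N : structure R (add_distance L)) :
  canonical_distance al' N -> saturates D (forget N) -> saturates D N.
Proof.
move=> cN; rewrite !saturates_indexed => sat c G.
pose LI := add_constants L I.
pose E : structure R (add_distance LI) := expand_by (M := pre_ultrapower N D) c.
(* Being canonical is expressed by sentences, so the theorem of Los carries it to the ultrapower. *)
have cP : canonical_distance al' (pre_ultrapower N D).
  apply/value_distance_axiom => n s.
  have : Th N (distance_axiom R al' n).
    split; first exact: sentence_distance_axiom.
    by move=> s'; apply: (proj1 (value_distance_axiom al' N)).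
  by rewrite -(Th_pre_ultrapower N D) => -[_].
pose alI k := omap (fun qx => (amap (constants_lmap L I) qx.1, qx.2)) (al' k).
have cE : canonical_distance alI E := canonical_expand_by (c := c) cP.
pose G' : set (formula R LI) := [set chi | exists phi e psi (e0 : 0 < e),
  [/\ G phi, forall s : nat -> E, `|value s phi - value (M := forget E) s psi| <= e &
    chi = excess_formula (ltW e0) psi (zero_formula R LI)]].
apply: (@satisfiable_transfer _ _ _ E
  (expand_by (M := pre_ultrapower (forget N) D) c) G G' id id).
- move=> _ [phi [e [psi [e0 [Gphi psiP ->]]]]]; exists phi => // s s0.
  apply/value_excess_eq0; rewrite subr0 -value_pre_ultrapower_forget.
  by have := psiP s; rewrite s0 sub0r normrN.
- move=> s sG phi Gphi; apply/eqP; rewrite eq_le.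
  case/andP: (value_01 (M := E) phi s) => -> _; rewrite andbT.
  apply/ler_addgt0Pr => e e0; rewrite add0r (splitr e).
  have e20 : 0 < e / 2 by rewrite divr_gt0.
  have [psi [_ psiP]] := @formula_approximation R LI alI phi _ e20.
  have : G' (excess_formula (ltW e20) psi (zero_formula R LI)).
    by exists phi, (e / 2), psi, e20; split=> // s'; exact: psiP cE s'.
  move=> /sG /value_excess_eq0; rewrite subr0 -value_pre_ultrapower_forget => psi_e.
  rewrite -(subrK (value (M := forget E) s psi) (value (M := E) s phi)).
  apply: lerD; last by apply: le_trans psi_e; rewrite ler_norm.
  by apply: le_trans (psiP E cE s); rewrite ler_norm.
- exact: sat.
Qed.

End SaturationTransfer.

Theorem theorem5p1 (R : realType) (V : vocabulary) (T : theory R V) :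
  continuous_theory T ->
  exists (V' : vocabulary) (U : theory R V'),
    metric_theory U /\ keisler_le T U /\ keisler_le U T.
Proof.
move=> [M0 ->]; have [al al_surj] := atom_enumeration V.
have [D0 D0_free] := nonprincipal_ultrafilter.
have [sig Msig] := metric_expansion_premetric M0 al_surj.
exists (distance_vocabulary V), (Th (metric_expansion al M0)); split; [|split].
- exists (ultrapower (metric_expansion al M0) D0); split.
    exists sig; apply: reduction_metric; first exact: premetric_pre_ultrapower.
    exact: pre_ultrapower_complete.
  by rewrite /ultrapower Th_reduction Th_pre_ultrapower.
- move=> I D [regD satD]; split=> // M MT.
  apply: (@saturates_expansion R I D V M _ (@dist_all_01 R V al M)); apply: satD.
  exact: Th_metric_expansion MT.
(* A model [N] of [U] need not be a metric structure; its [d] is controlled through the distance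
   axioms, which belong to [U]. *)
- move=> I D [regD satD]; split=> // N NU.
  apply: (@saturates_forget R I D V al).
    apply/value_distance_axiom => n s.
    suff /NU[_] : Th (metric_expansion al M0) (distance_axiom R al n) by [].
    split=> [|s']; first exact: sentence_distance_axiom.
    exact/(proj1 (value_distance_axiom al _))/canonical_expansion.
  apply: satD => phi [sphi v0]; apply: Th_forget => //; apply: NU.
  split=> [|s]; first exact: sentence_phmap.
  by rewrite value_phmap value_forget_expansion.
Qed.
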